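(* Let $X,Y\in\mathrm{Sym}^+(3)$, let $d_1,d_2,d_3$ be the eigenvalues of $X$ and $\lambda_1,\lambda_2,\lambda_3$ the eigenvalues of $Y$ (in no particular order). The scaling–rotation distance is computed as follows. (i) If the eigenvalues of $X$ (and also of $Y$) are all distinct, then there are exactly twenty-four versions of $X$, denoted by $(U_i,D_i)$, $i=1,\dots,24$, and for any version $(V,\Lambda)$ of $Y$, $$d_{\mathcal{SR}}(X,Y)=\min_{i=1,\dots,24}d\big((U_i,D_i),(V,\Lambda)\big).$$ (ii) If $d_1=d_2\ne d_3$ and $\lambda_1,\lambda_2,\lambda_3$ are distinct, then for any version $(V,\Lambda)$ of $Y$ and a version $(U,D)$ of $X$ satisfying $D=\mathrm{diag}(d_1,d_1,d_3)$, $$d_{\mathcal{SR}}(X,Y)=\min_{i=1,2,3,\ j=1,2}d\big((\hat U_{\sigma_j,\pi_i},D_{\pi_i}),(V,\Lambda)\big),$$ where $(\hat U_{\sigma_j,\pi_i},D_{\pi_i})$, $i=1,2,3$, $j=1,2$, are the six minimally rotated versions. (iii) If $d_1=d_2\ne d_3$ and $\lambda_1=\lambda_2\ne\lambda_3$, choose $D=\mathrm{diag}(d_1,d_2,d_3)$ and $\Lambda=\mathrm{diag}(\lambda_1,\lambda_2,\lambda_3)$. For any versions $(U,D)$ and $(V,\Lambda)$ of $X$ and $Y$, $$d_{\mathcal{SR}}(X,Y)=\min_{i=1,2,3,\ j=1,2}d\big((UR_{\theta_{ij}}I_{\sigma_j}P_{\pi_i}',D_{\pi_i}),(VR_{\phi_{ij}},\Lambda)\big),$$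 where $(\theta_{ij},\phi_{ij})$ simultaneously maximizes $G(\theta,\phi)=\mathrm{trace}(UR_\theta I_{\sigma_j}P_{\pi_i}'R_\phi'V')$. (iv) If $d_1=d_2=d_3$, then with $D=\mathrm{diag}(d_1,d_1,d_1)$, for any version $(V,\Lambda)$ of $Y$, $$d_{\mathcal{SR}}(X,Y)=d\big((V,D),(V,\Lambda)\big),$$ regardless of whether the eigenvalues of $Y$ are distinct or not.
   Context: A prime denotes transpose. $\mathrm{Sym}^+(p)$ is the set of real symmetric positive-definite $p\times p$ matrices; $\mathrm{SO}(p)$ the set of rotation matrices; $\mathrm{Diag}^+(p)$ the set of diagonal matrices with positive diagonal entries (in no particular order). A version of $X\in\mathrm{Sym}^+(p)$ is a pair $(U,D)\in\mathrm{SO}(p)\times\mathrm{Diag}^+(p)$ with $X=UDU'$; $\mathcal{E}_X$ is the set of all versions of $X$. Fix $k>0$. On $\mathrm{SO}(p)\times\mathrm{Diag}^+(p)$ the geodesic distance $d$ is $$d^2\big((U,D),(V,\Lambda)\big)=\frac{k}{2}\|\log(VU')\|_F^2+\|\log(\Lambda D^{-1})\|_F^2,$$ where $\|\cdot\|_F$ is the Frobenius norm; for $R\in\mathrm{SO}(p)$, $\log(R)$ is an antisymmetric $A$ with $\exp(A)=R$ of smallest Frobenius norm (any choice if not unique), and on $\mathrm{Diag}^+(p)$ $\log$ is the entrywise logarithm of the diagonal. The scaling–rotation distance is $d_{\mathcal{SR}}(X,Y)=\inf\{d((U,D),(V,\Lambda)):(U,D)\in\mathcal{E}_X,\ (V,\Lambda)\in\mathcal{E}_Y\}$.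 For a permutation $\pi$ of $\{1,2,3\}$, $P_\pi^0$ is the matrix whose entries are all $0$ except that in column $i$ the entry in row $\pi(i)$ equals $1$; $P_\pi=P_\pi^0$ if $\det P_\pi^0=1$, and $P_\pi=\mathrm{diag}(-1,1,1)P_\pi^0$ otherwise; $D_\pi=P_\pi DP_\pi'=\mathrm{diag}(d_{\pi^{-1}(1)},d_{\pi^{-1}(2)},d_{\pi^{-1}(3)})$ for $D=\mathrm{diag}(d_1,d_2,d_3)$. For $\sigma=(\epsilon_1,\epsilon_2,\epsilon_3)$ with $\epsilon_i\in\{\pm1\}$, $\epsilon_1\epsilon_2\epsilon_3=1$, $I_\sigma=\mathrm{diag}(\epsilon_1,\epsilon_2,\epsilon_3)$. $\pi_1,\pi_2,\pi_3$ are the permutations rearranging the triple $(1,2,3)$ into $(1,2,3)$, $(3,1,2)$, $(1,3,2)$ respectively, i.e. $D_{\pi_1}=\mathrm{diag}(d_1,d_2,d_3)$, $D_{\pi_2}=\mathrm{diag}(d_3,d_1,d_2)$, $D_{\pi_3}=\mathrm{diag}(d_1,d_3,d_2)$. Also $\sigma_1=(1,1,1)$, $\sigma_2=(-1,1,-1)$. $R_\theta=\exp([a]_\times)$ with $a=(0,0,\theta)'$, i.e. $R_\theta=\begin{bmatrix}\cos\theta&-\sin\theta&0\\ \sin\theta&\cos\theta&0\\0&0&1\end{bmatrix}$, $\theta\in\mathbb{R}$. Minimally rotated versions (for $D=\mathrm{diag}(d_1,d_1,d_3)$, $d_1\neq d_3$, given $(U,D)$ and $(V,\Lambda)$): $\hat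 U_{\sigma,\pi}=U\hat R_{\sigma,\pi}I_\sigma P_\pi'$, where the minimal rotation $\hat R_{\sigma,\pi}$ is a matrix of the form $R=\begin{bmatrix}R_{11}&0\\0&1\end{bmatrix}$, $R_{11}\in\mathrm{SO}(2)$, minimizing $d((URI_\sigma P_\pi',D_\pi),(V,\Lambda))$ over all $R$ of this form. *)

(* Defs.v *)
From HB Require Import structures.
From mathcomp Require Import all_boot all_order all_algebra all_fingroup.
From mathcomp Require Import all_classical all_reals all_analysis.

Set Implicit Arguments.
Unset Strict Implicit.
Unset Printing Implicit Defensive.

Import Order.TTheory GRing.Theory Num.Theory.
Import numFieldNormedType.Exports.

Local Open Scope classical_set_scope.
Local Open Scope ring_scope.

Section GeneralDimension.
Context {R : realType} {p : nat}.
Implicit Types (A B U V D L X Y : 'M[R]_p).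

Definition symPos : set 'M[R]_p :=
  [set X | X^T = X /\ forall v : 'cV[R]_p, v != 0 -> 0 < (v^T *m X *m v) 0 0].

Definition rotation : set 'M[R]_p := [set U | U *m U^T = 1%:M /\ \det U = 1].

Definition diagPos : set 'M[R]_p :=
  [set D | is_diag_mx D /\ forall i, 0 < D i i].

Definition frobenius A : R := Num.sqrt (\sum_i \sum_j A i j ^+ 2).

Definition expmx A : 'M[R]_p :=
  \matrix_(i, j)
    limn (series (fun n => n`!%:R^-1 * (A ^+ n) i j) : R^nat).

Definition is_log_rot U A : Prop :=
  [/\ A^T = - A, expmx A = U &
      forall B, B^T = - B -> expmx B = U -> frobenius A <= frobenius B].

(* An arbitrary choice among the minimal antisymmetric logarithms; the default
   value 0 is only used when there is none. *)
Definition log_rot U : 'M[R]_p := xget 0 [set A | is_log_rot U A].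

Definition log_diag D : 'M[R]_p := diag_mx (\row_i ln (D i i)).

Definition versions X : set ('M[R]_p * 'M[R]_p) :=
  [set UD | [/\ rotation UD.1, diagPos UD.2 & X = UD.1 *m UD.2 *m UD.1^T]].

Definition geo_dist (k : R) (UD VL : 'M[R]_p * 'M[R]_p) : R :=
  Num.sqrt (k / 2 * frobenius (log_rot (VL.1 *m UD.1^T)) ^+ 2
            + frobenius (log_diag (VL.2 *m invmx UD.2)) ^+ 2).

Definition sr_dist (k : R) X Y : R :=
  inf [set t | exists UD VL,
         [/\ versions X UD, versions Y VL & t = geo_dist k UD VL]].

End GeneralDimension.

(* The starting value is a member of the family, so this is its minimum. *)
Definition min_ord {R : realType} {n : nat} (F : 'I_n.+1 -> R) : R :=
  \big[Num.min/F ord0]_(i < n.+1) F i.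

Section DimensionThree.
Context {R : realType}.

Definition row3 (a b c : R) : 'rV[R]_3 := \row_(i < 3) [:: a; b; c]`_i.

Definition diag3 (a b c : R) : 'M[R]_3 := diag_mx (row3 a b c).

(* The eigenvalues listed with multiplicity. *)
Definition eigenvalues3 (X : 'M[R]_3) (a b c : R) : Prop :=
  char_poly X = ('X - a%:P) * ('X - b%:P) * ('X - c%:P).

Definition perm0_mx (s : 'S_3) : 'M[R]_3 := \matrix_(r, c) (r == s c)%:R.

Definition rperm_mx (s : 'S_3) : 'M[R]_3 :=
  if \det (perm0_mx s) == 1 then perm0_mx s
  else diag3 (-1) 1 1 *m perm0_mx s.

Definition diag_act (D : 'M[R]_3) (s : 'S_3) : 'M[R]_3 :=
  rperm_mx s *m D *m (rperm_mx s)^T.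

(* Indices start at 0; the second permutation is the cycle i |-> i + 1, which
   moves d_i to position i + 1, so it sends diag(d1, d2, d3) to
   diag(d3, d1, d2). *)
Definition pis (i : 'I_3) : 'S_3 :=
  nth 1%g [:: 1%g; perm (@addIr 'I_3 1); tperm (inord 1) (inord 2)] i.

Definition sigmas (j : 'I_2) : 'rV[R]_3 :=
  nth 0 [:: row3 1 1 1; row3 (-1) 1 (-1)] j.

Definition rotz (t : R) : 'M[R]_3 :=
  \matrix_(i < 3, j < 3)
    nth 0 (nth [::] [:: [:: cos t; - sin t; 0];
                        [:: sin t; cos t; 0];
                        [:: 0; 0; 1]] i) j.

Definition block_rot : set 'M[R]_3 :=
  [set B | exists2 B11 : 'M[R]_2, rotation B11 &
     B = block_mx B11 0 0 (1%:M : 'M[R]_1) :> 'M[R]_(2 + 1)].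

Definition rotated (U B : 'M[R]_3) (sg : 'rV[R]_3) (s : 'S_3) : 'M[R]_3 :=
  U *m B *m diag_mx sg *m (rperm_mx s)^T.

Definition minimal_rotation (k : R) (UD VL : 'M[R]_3 * 'M[R]_3)
    (sg : 'rV[R]_3) (s : 'S_3) (B : 'M[R]_3) : Prop :=
  let cost C := geo_dist k (rotated UD.1 C sg s, diag_act UD.2 s) VL in
  block_rot B /\ forall C, block_rot C -> cost B <= cost C.

Definition maximizes_trace (U V : 'M[R]_3) (sg : 'rV[R]_3) (s : 'S_3)
    (theta phi : R) : Prop :=
  let G t u := \tr (U *m rotz t *m diag_mx sg *m (rperm_mx s)^T
                    *m (rotz u)^T *m V^T) in
  forall t u, G t u <= G theta phi.

End DimensionThree.

(* Main.v *)
Require Import Defs.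
From HB Require Import structures.
From mathcomp Require Import all_boot all_order all_algebra all_fingroup.
From mathcomp Require Import all_classical all_reals all_analysis.
From mathcomp Require Import ring lra.

Set Implicit Arguments.
Unset Strict Implicit.
Unset Printing Implicit Defensive.

Import Order.TTheory GRing.Theory Num.Theory.
Import numFieldNormedType.Exports.

Local Open Scope classical_set_scope.
Local Open Scope ring_scope.

(* A rotation U of R^3 is Q^T R_t Q, and Rodrigues' formula shows that every
   antisymmetric logarithm of U has squared Frobenius norm 2 t^2 with
   1 + 2 cos t = tr U.  Hence the minimal one has t = acos ((tr U - 1) / 2), and
   comparing two distances with the same diagonal parts amounts to comparing
   the traces tr (V U^T).

   Two versions of the same matrix differ by U' = U W P_s^T, D' = P_s D P_s^T
   with W a rotation commuting with D.  If the eigenvalues are distinct then W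
   is a diagonal sign matrix, which gives 6 * 4 = 24 versions; if D is
   diag (a, a, c) then W = R_t I_sigma with sigma one of two sign vectors, and
   s matters only through the position of c, which gives 3 * 2 families.

   A signed permutation acting on the right of both versions preserves the
   distance, so the version of Y can be brought to a fixed frame; the infimum
   is then over finitely many families, and on each family it is attained by
   compactness of the circle. *)

(** * Orthogonal matrices and the diagonalization of symmetric matrices *)

Section Orthogonal.
Context {R : realType}.

Lemma mulmx_tr_row n (v : 'rV[R]_n) : (v *m v^T) 0 0 = \sum_i v 0 i ^+ 2.
Proof. by rewrite mxE; apply: eq_bigr => i _; rewrite mxE. Qed.

Lemma sqr_row_gt0 n (v : 'rV[R]_n) : v != 0 -> 0 < (v *m v^T) 0 0.
Proof.
move=> vn0; rewrite mulmx_tr_row lt0r sumr_ge0 ?andbT; last first.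
  by move=> i _; exact: sqr_ge0.
apply: contra vn0; rewrite psumr_eq0; last by move=> i _; exact: sqr_ge0.
move=> /allP h; apply/eqP/rowP => i; rewrite mxE; apply/eqP.
by rewrite -sqrf_eq0; have := h i; rewrite mem_index_enum => /(_ isT).
Qed.

Lemma unit_row_multiple n (v : 'rV[R]_n) : v != 0 ->
  exists2 a, a != 0 & (a *: v) *m (a *: v)^T = 1%:M.
Proof.
move=> /sqr_row_gt0; set q := (X in 0 < X) => q0.
exists (Num.sqrt q)^-1; first by rewrite invr_eq0 gt_eqF // sqrtr_gt0.
rewrite linearZ /= -scalemxAr -scalemxAl scalerA [v *m _]mx11_scalar.
rewrite -/q -invfM -expr2 sqr_sqrtr ?ltW // scale_scalar_mx mulVf //.
by rewrite gt_eqF.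
Qed.

(* A Householder reflection in the hyperplane orthogonal to [u - v]. *)
Lemma orthogonal_moving_row n (u v : 'rV[R]_n) :
  u *m u^T = 1%:M -> v *m v^T = 1%:M ->
  exists2 Q : 'M[R]_n, Q *m Q^T = 1%:M & u *m Q = v.
Proof.
move=> uu vv; have [->|uv] := eqVneq u v.
  by exists 1%:M; rewrite ?trmx1 ?mulmx1.
pose w := u - v; have w0 : w != 0 by rewrite subr_eq0.
pose q := (w *m w^T) 0 0; have q0 : q != 0 by rewrite gt_eqF // sqr_row_gt0.
have ww : w *m w^T = q%:M by rewrite [LHS]mx11_scalar.
have uvC : v *m u^T = u *m v^T.
  by rewrite -[RHS]trmxK trmx_mul trmxK [v *m _]mx11_scalar tr_scalar_mx.
pose Q := 1%:M - (2 / q) *: (w^T *m w).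
have Qt : Q^T = Q.
  by rewrite /Q linearB /= trmx1 linearZ /= trmx_mul trmxK.
(* As [u] and [v] have equal length, the inner product of [u] and [u - v] is half of |u - v|^2, so
   the reflection subtracts exactly [w] from [u]. *)
have uw : u *m w^T = (q / 2)%:M.
  apply: (scalerI (_ : 2 != 0 :> R)); first by rewrite pnatr_eq0.
  rewrite scale_scalar_mx [2 * _]mulrC divfK ?pnatr_eq0 // -ww /w.
  rewrite linearB /= mulmxBl !mulmxBr uu vv uvC.
  set t := u *m v^T.
  by apply/matrixP => i j; move: t => t; rewrite !mxE; ring.
have uwv : u - w = v by rewrite /w subKr.
clearbody w; exists Q.
  have PP : w^T *m w *m (w^T *m w) = q *: (w^T *m w).
    by rewrite mulmxA -(mulmxA w^T) ww mul_mx_scalar -scalemxAl.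
  rewrite Qt /Q mulmxBl mul1mx mulmxBr mulmx1 -scalemxAl -!scalemxAr PP.
  by move: (w^T *m w) => P; apply/matrixP => i j; rewrite !mxE; field.
rewrite /Q mulmxBr mulmx1 -scalemxAr mulmxA uw mul_scalar_mx scalerA.
by rewrite (_ : 2 / q * (q / 2) = 1) ?scale1r //; field.
Qed.

Lemma char_poly_conj n (Q X : 'M[R]_n) : Q *m Q^T = 1%:M ->
  char_poly (Q *m X *m Q^T) = char_poly X.
Proof.
move=> QQ; rewrite /char_poly /char_poly_mx.
have -> : 'X%:M - map_mx polyC (Q *m X *m Q^T) =
   map_mx polyC Q *m ('X%:M - map_mx polyC X) *m map_mx polyC Q^T.
  rewrite mulmxBr mulmxBl -!map_mxM /=; congr (_ - _).
  by rewrite mul_mx_scalar -scalemxAl -map_mxM QQ map_mx1 scalemx1.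
rewrite !det_mulmx mulrAC -det_mulmx -map_mxM QQ map_mx1 det1 mul1r //.
Qed.

Lemma char_poly_block_diag m n (A : 'M[R]_m) (B : 'M[R]_n) :
  char_poly (block_mx A 0 0 B) = char_poly A * char_poly B.
Proof. by rewrite /char_poly char_block_diag_mx det_ublock. Qed.

(** Induction on the dimension: a unit eigenvector for a listed root is moved to the first basis
    vector, and symmetry then splits off a 1 x 1 block. The splitting of the characteristic
    polynomial is what [eigenvalues3] supplies, and it passes to the smaller block. *)
Lemma spectral_split n (X : 'M[R]_n) (s : seq R) :
  X^T = X -> char_poly X = \prod_(a <- s) ('X - a%:P) ->
  exists Q (d : 'rV_n), Q *m Q^T = 1%:M /\ Q *m X *m Q^T = diag_mx d.
Proof.
elim: n X s => [|n IH] X s Xs cX.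
  exists 1%:M, 0; split; first by rewrite trmx1 mulmx1.
  by apply/matrixP => -[].
case: s cX => [|a s] cX.
  have := size_char_poly X; rewrite cX big_nil size_poly1 => -[] //.
rewrite big_cons in cX; have : eigenvalue X a.
  by rewrite eigenvalue_root_char cX rootM root_XsubC eqxx.
move=> /eigenvalueP[v vX /unit_row_multiple[b b0 bv]].
have eb : (delta_mx 0 0 : 'rV[R]_n.+1) *m (delta_mx 0 0)^T = 1%:M.
  rewrite trmx_delta mul_delta_mx; apply/matrixP => i j.
  by rewrite !ord1 !mxE.
have [Q QQ eQ] := @orthogonal_moving_row n.+1 _ _ eb bv.
(* The conjugate is kept opaque, with its size written [1 + n] so that block decompositions
   apply. *)
have [M MQ] : exists M : 'M[R]_(1 + n), M = Q *m X *m Q^T by eexists.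
have Ms : M^T = M by rewrite MQ !trmx_mul trmxK Xs mulmxA.
have eM : (delta_mx 0 0 : 'rV[R]_n.+1) *m M = a *: delta_mx 0 0.
  rewrite MQ !mulmxA eQ -scalemxAl vX scalerA mulrC -scalerA -scalemxAl -eQ.
  by rewrite -mulmxA QQ mulmx1.
have M0 j : M 0 j = a * (j == 0)%:R.
  by move/matrixP: eM => /(_ 0 j); rewrite -rowE !mxE eqxx.
have Mblock : M = block_mx a%:M 0 0 (drsubmx M).
  have l0 : lshift n (0 : 'I_1) = 0 by exact: val_inj.
  rewrite -[LHS]submxK; congr block_mx; apply/matrixP => i j.
  - by rewrite !ord1 !mxE l0 M0 mulr1.
  - by rewrite !ord1 !mxE l0 M0 mulr0.
  - by rewrite -Ms !ord1 !mxE l0 M0 mulr0.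
(* Cancelling the common factor X - a leaves the remaining roots to the lower block. *)
have Xa0 : 'X - a%:P != 0 by rewrite polyXsubC_eq0.
have cN : char_poly (drsubmx M) = \prod_(b <- s) ('X - b%:P).
  apply: (mulfI Xa0); rewrite -cX -(char_poly_conj X QQ) -MQ Mblock.
  rewrite block_mxKdr [RHS](char_poly_block_diag (a%:M : 'M[R]_1)); congr (_ * _).
  by rewrite [RHS]det_mx11 !mxE eqxx.
have Ns : (drsubmx M)^T = drsubmx M.
  by rewrite trmx_drsub Ms.
have [P [d [PP Pd]]] := IH _ _ Ns cN.
pose B : 'M[R]_(1 + n) := block_mx 1%:M 0 0 P.
have Bt : B^T = block_mx 1%:M 0 0 P^T.
  by rewrite /B tr_block_mx !trmx0 trmx1.
have BB : B *m B^T = 1%:M.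
  rewrite Bt mulmx_block !mulmx0 !mul0mx mulmx1 !addr0 add0r PP.
  by rewrite -scalar_mx_block.
have BM : B *m M *m B^T = diag_mx (row_mx (a%:M : 'rV[R]_1) d).
  rewrite Bt Mblock !mulmx_block.
  rewrite !mulmx0 !mul0mx !mulmx1 !mul1mx !addr0 !add0r Pd diag_mx_row.
  by rewrite mul0mx; congr block_mx; apply/matrixP => i j; rewrite !ord1 !mxE.
exists (B *m Q : 'M[R]_n.+1), (row_mx (a%:M : 'rV[R]_1) d); split.
  by rewrite trmx_mul mulmxA -[B *m Q *m _]mulmxA QQ mulmx1.
by rewrite trmx_mul !mulmxA -2!(mulmxA B) -MQ.
Qed.

End Orthogonal.

(** * The exponential of a matrix with A^3 = - t^2 A *)

Section Exponential.
Context {R : realType} {p : nat}.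
Implicit Types A : 'M[R]_p.

Lemma exprmx_odd A t n : A *m A *m A = - t ^+ 2 *: A ->
  A ^+ n.*2.+1 = ((-1) ^+ n * t ^+ n.*2) *: A.
Proof.
move=> A3; elim: n => [|n IH]; first by rewrite double0 expr1 !expr0 mulr1 scale1r.
rewrite doubleS 2!exprSr IH -!mulmxE -!scalemxAl A3 scalerA !exprS.
by congr (_ *: _); ring.
Qed.

Lemma exprmx_even A t n : A *m A *m A = - t ^+ 2 *: A ->
  A ^+ n.*2.+2 = ((-1) ^+ n * t ^+ n.*2) *: (A *m A).
Proof. by move=> A3; rewrite exprSr (exprmx_odd _ A3) -mulmxE -scalemxAl. Qed.

(** Odd powers are multiples of A and positive even powers multiples of A^2, with the sine and
    cosine coefficients up to powers of t. The cosine pattern is wrong only at n = 0, where the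
    power is the identity; the term carrying [(n == 0)%:R] corrects it. *)
Lemma expmx_term A t n i j : t != 0 -> A *m A *m A = - t ^+ 2 *: A ->
  n`!%:R^-1 * (A ^+ n) i j =
  (n == 0)%:R * (1%:M i j + t ^- 2 * (A *m A) i j)
  + (A i j / t) * sin_coeff t n - (t ^- 2 * (A *m A) i j) * cos_coeff t n.
Proof.
move=> t0 A3; rewrite /sin_coeff /cos_coeff /= -!exprnP.
case: n => [|n]; first by rewrite expr0 /= fact0; field.
rewrite mul0r add0r -(odd_double_half n); case: (odd n); rewrite /= ?add0n ?add1n.
  rewrite (exprmx_even _ A3) mxE /= negbK !odd_double /= !doubleK !exprS.
  by field; rewrite t0 /= pnatr_eq0 -lt0n fact_gt0.
rewrite (exprmx_odd _ A3) mxE /= odd_double /= uphalf_double doubleK !exprS.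
by field; rewrite t0 /= pnatr_eq0 -lt0n fact_gt0.
Qed.

Lemma series_delta0 (a : R) : series (fun n => (n == 0)%:R * a) @ \oo --> a.
Proof.
(* The partial sum of index 0 is empty, so the sequence is constant only after a shift by one. *)
rewrite -cvg_shiftS; apply: cvg_near_cst; near=> n.
rewrite /series /= big_nat_recl //= mul1r big1 ?addr0 // => i _.
by rewrite mul0r.
Unshelve. all: by end_near. Qed.

(** Rodrigues' formula, obtained by summing [expmx_term] entry by entry as a combination of three
    convergent series. *)
Lemma expmx_rodrigues A t : t != 0 -> A *m A *m A = - t ^+ 2 *: A ->
  expmx A = 1%:M + (sin t / t) *: A + ((1 - cos t) / t ^+ 2) *: (A *m A).
Proof.
move=> t0 A3; apply/matrixP => i j; rewrite [LHS]mxE.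
set b := (A *m A) i j.
under eq_fun do rewrite (expmx_term _ _ _ t0 A3).
have cs : series (sin_coeff t) @ \oo --> sin t.
  by rewrite sin.unlock; exact: is_cvg_series_sin_coeff.
have cc : series (cos_coeff t) @ \oo --> cos t.
  by rewrite cos.unlock; exact: is_cvg_series_cos_coeff.
set a := A i j; set e := 1%:M i j.
have c : series (fun n => (n == 0)%:R * (e + t ^- 2 * b) + a / t * sin_coeff t n
    - t ^- 2 * b * cos_coeff t n) @ \oo -->
    (e + t ^- 2 * b) + a / t * sin t - t ^- 2 * b * cos t.
  rewrite (_ : series _ = fun n => series (fun n => (n == 0)%:R * (e + t ^- 2 * b)) n
     + (a / t) * series (sin_coeff t) n - (t ^- 2 * b) * series (cos_coeff t) n).
    apply: cvgB; last by apply: cvgM => //; exact: cvg_cst.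
    apply: cvgD; first exact: series_delta0.
    by apply: cvgM => //; exact: cvg_cst.
  apply/funext => n; rewrite /series /= big_split big_split /= sumrN.
  by rewrite -!mulr_sumr.
rewrite (cvg_lim _ c) // /a /e /b !mxE.
by field.
Qed.

(** This covers the angle t = 0, by which Rodrigues' formula would divide. *)
Lemma expmx0 : expmx (0 : 'M[R]_p) = 1%:M.
Proof.
apply/matrixP => i j; rewrite [LHS]mxE; apply: cvg_lim => //.
rewrite (_ : (fun n => _) = fun n => (n == 0)%:R * 1%:M i j).
  exact: series_delta0.
apply/funext => -[|n]; first by rewrite fact0 invr1 expr0.
by rewrite expr0n /= mxE mulr0 mul0r.
Qed.

End Exponential.

(** * Explicit 3 x 3 matrices, and the lower bound on the norm of a logarithm *)

Notation o0 := (@Ordinal 3 0 isT).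
Notation o1 := (@Ordinal 3 1 isT).
Notation o2 := (@Ordinal 3 2 isT).

Section Three.
Context {R : realType}.
Implicit Types A B U : 'M[R]_3.

Lemma forall_ord3 (P : 'I_3 -> Prop) : P o0 -> P o1 -> P o2 -> forall i, P i.
Proof.
move=> P0 P1 P2 [[|[|[|//]]] ilt].
- by rewrite (_ : Ordinal ilt = o0) //; exact: val_inj.
- by rewrite (_ : Ordinal ilt = o1) //; exact: val_inj.
- by rewrite (_ : Ordinal ilt = o2) //; exact: val_inj.
Qed.

Lemma big_ord3 (F : 'I_3 -> R) : \sum_i F i = F o0 + F o1 + F o2.
Proof.
rewrite !big_ord_recl big_ord0 addr0 addrA.
by congr (_ + _ + _); congr F; exact: val_inj.
Qed.

Lemma prod_ord3 (F : 'I_3 -> R) : \prod_i F i = F o0 * F o1 * F o2.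
Proof.
rewrite !big_ord_recl big_ord0 mulr1 mulrA.
by congr (_ * _ * _); congr F; exact: val_inj.
Qed.

(** With all nine entries as arguments, a matrix identity reduces by [congr mx3] to ring identities
    between entries. *)
Definition mx3 (a b c d e f g h i : R) : 'M[R]_3 :=
  \matrix_(r < 3, s < 3)
    nth 0 (nth [::] [:: [:: a; b; c]; [:: d; e; f]; [:: g; h; i]] r) s.

Lemma mx3E A : A = mx3 (A o0 o0) (A o0 o1) (A o0 o2)
  (A o1 o0) (A o1 o1) (A o1 o2) (A o2 o0) (A o2 o1) (A o2 o2).
Proof.
apply/matrixP => i j.
by elim/forall_ord3: i; elim/forall_ord3: j; rewrite mxE.
Qed.

Lemma mulmx3 a b c d e f g h i a' b' c' d' e' f' g' h' i' :
  mx3 a b c d e f g h i *m mx3 a' b' c' d' e' f' g' h' i' =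
  mx3 (a * a' + b * d' + c * g') (a * b' + b * e' + c * h')
      (a * c' + b * f' + c * i')
      (d * a' + e * d' + f * g') (d * b' + e * e' + f * h')
      (d * c' + e * f' + f * i')
      (g * a' + h * d' + i * g') (g * b' + h * e' + i * h')
      (g * c' + h * f' + i * i').
Proof. by rewrite [LHS]mx3E; congr mx3; rewrite mxE big_ord3 !mxE. Qed.

Lemma scalemx3 x a b c d e f g h i : x *: mx3 a b c d e f g h i =
  mx3 (x * a) (x * b) (x * c) (x * d) (x * e) (x * f) (x * g) (x * h) (x * i).
Proof. by rewrite [LHS]mx3E; congr mx3; rewrite !mxE. Qed.

Lemma addmx3 a b c d e f g h i a' b' c' d' e' f' g' h' i' :
  mx3 a b c d e f g h i + mx3 a' b' c' d' e' f' g' h' i' =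
  mx3 (a + a') (b + b') (c + c') (d + d') (e + e') (f + f')
      (g + g') (h + h') (i + i').
Proof. by rewrite [LHS]mx3E; congr mx3; rewrite !mxE. Qed.

Lemma trmx3 a b c d e f g h i :
  (mx3 a b c d e f g h i)^T = mx3 a d g b e h c f i.
Proof. by rewrite [LHS]mx3E; congr mx3; rewrite !mxE. Qed.

Lemma scalar_mx3 x : x%:M = mx3 x 0 0 0 x 0 0 0 x.
Proof. by rewrite [LHS]mx3E; congr mx3; rewrite !mxE. Qed.

Lemma mxtrace3 A : \tr A = A o0 o0 + A o1 o1 + A o2 o2.
Proof. exact: big_ord3. Qed.

Lemma det2 (B : 'M[R]_2) : \det B = B 0 0 * B 1 1 - B 0 1 * B 1 0.
Proof.
rewrite (expand_det_row _ ord0) !big_ord_recl big_ord0 /cofactor !det_mx11.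
rewrite !mxE /= !expr0 addr0 mul1r expr1 mulN1r mulrN.
by congr (_ * B _ _ - B _ _ * B _ _); exact: val_inj.
Qed.

Lemma det3 a b c d e f g h i : \det (mx3 a b c d e f g h i) =
  a * e * i + b * f * g + c * d * h - c * e * g - b * d * i - a * f * h.
Proof.
rewrite (expand_det_row _ ord0) !big_ord_recl big_ord0 /cofactor.
rewrite !det2 !mxE /=; ring.
Qed.

Lemma rotzE (t : R) : rotz t = mx3 (cos t) (- sin t) 0 (sin t) (cos t) 0 0 0 1.
Proof. by []. Qed.

Lemma rotzN (t : R) : rotz (- t) = (rotz t)^T.
Proof. by rewrite !rotzE trmx3 cosN sinN opprK. Qed.

Lemma rotation_rotz (t : R) : rotation (rotz t).
Proof.
have cs : cos t * cos t + sin t * sin t = 1 by rewrite -!expr2 cos2Dsin2.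
split; last by rewrite rotzE det3 -[RHS]cs; ring.
rewrite rotzE trmx3 mulmx3 scalar_mx3.
by congr mx3; first [ring | rewrite -[RHS]cs; ring].
Qed.

Lemma frobenius_sqr A : frobenius A ^+ 2 = \tr (A *m A^T).
Proof.
rewrite sqr_sqrtr; last first.
  by rewrite sumr_ge0 // => i _; rewrite sumr_ge0 // => j _; exact: sqr_ge0.
apply: eq_bigr => i _; rewrite mxE.
by apply: eq_bigr => j _; rewrite mxE expr2.
Qed.

Lemma skew_mx3 A : A^T = - A ->
  exists a b c, A = mx3 0 a b (- a) 0 c (- b) (- c) 0.
Proof.
move=> /matrixP At; exists (A o0 o1), (A o0 o2), (A o1 o2).
have e i j : A j i = - A i j by have := At i j; rewrite !mxE.
have d i : A i i = 0 by have := e i i; lra.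
by rewrite {1}[A]mx3E !d (e o0 o1) (e o0 o2) (e o1 o2).
Qed.

(** For the cross product matrix of a vector w this is the Cayley-Hamilton identity A^3 = - |w|^2 A,
    the squared Frobenius norm being 2 |w|^2. It makes Rodrigues' formula applicable with t^2 half
    the squared norm. *)
Lemma skew_cube A : A^T = - A ->
  A *m A *m A = - (frobenius A ^+ 2 / 2) *: A.
Proof.
move=> At; rewrite frobenius_sqr At.
have [a [b [c ->]]] := skew_mx3 At.
rewrite mulmxN linearN /= !mulmx3 scalemx3 mxtrace3 !mxE /=.
by congr mx3; field.
Qed.

Lemma skew_trace_expmx A t : A^T = - A -> t != 0 ->
  frobenius A ^+ 2 = 2 * t ^+ 2 -> \tr (expmx A) = 1 + 2 * cos t.
Proof.
move=> At t0 At2; have A3 := skew_cube At.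
rewrite (expmx_rodrigues t0); last by rewrite A3 At2; congr (_ *: _); field.
rewrite !raddfD /= !linearZ /= mxtrace_scalar.
have -> : \tr (A *m A) = - (2 * t ^+ 2).
  by rewrite -At2 frobenius_sqr At mulmxN linearN /= opprK.
have -> : \tr A = 0.
  by have [a [b [c ->]]] := skew_mx3 At; rewrite mxtrace3 !mxE /= !addr0.
by field.
Qed.

(** The angle in [0, pi] of a rotation of space, whose trace is 1 + 2 cos t. *)
Definition rotangle U : R := acos ((\tr U - 1) / 2).

Lemma acos_cos_le (t : R) : 0 <= t -> acos (cos t) <= t.
Proof.
move=> t0; have [tpi|pit] := leP t pi.
  by rewrite cosK // in_itv /= t0.
apply: le_trans (ltW pit); apply: acos_lepi.
by rewrite cos_geN1 cos_le1.
Qed.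

(** The trace of the exponential shows that t, the Frobenius norm of A over the square root of 2,
    has the same cosine as the angle of [expmx A]; and acos (cos t) is at most t for t
    nonnegative. *)
Lemma rotangle_le_log A : A^T = - A ->
  2 * rotangle (expmx A) ^+ 2 <= frobenius A ^+ 2.
Proof.
move=> At; pose t := Num.sqrt (frobenius A ^+ 2 / 2).
have t2 : frobenius A ^+ 2 = 2 * t ^+ 2.
  by rewrite [t ^+ 2]sqr_sqrtr ?divr_ge0 ?sqr_ge0 //; field.
(* Rodrigues' formula divides by t, so t = 0 is treated apart; there A itself vanishes. *)
have [t0|t0] := eqVneq t 0.
  have [a [b [c Aabc]]] := skew_mx3 At.
  have : 2 * (a ^+ 2 + b ^+ 2 + c ^+ 2) = 0.
    rewrite t0 frobenius_sqr Aabc trmx3 mulmx3 mxtrace3 !mxE /= in t2.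
    by move: t2; rewrite expr0n /=; lra.
  move=> abc; have [a0 b0 c0] : [/\ a = 0, b = 0 & c = 0] by split; nra.
  have -> : A = 0.
    by rewrite Aabc a0 b0 c0 !oppr0 [RHS]mx3E; congr mx3; rewrite mxE.
  rewrite expmx0 /rotangle mxtrace_scalar (_ : (_ - 1) / 2 = 1).
    by rewrite acos1 expr0n /= mulr0 sqr_ge0.
  by field.
have tge0 : 0 <= t by exact: sqrtr_ge0.
rewrite t2 /rotangle (skew_trace_expmx At t0 t2).
rewrite (_ : (_ - 1) / 2 = cos t); last by field.
by rewrite ler_pM2l // lerXn2r ?nnegrE ?acos_ge0 ?acos_cos_le // cos_geN1 cos_le1.
Qed.

End Three.

(** * Minimal logarithms of rotations and their relation to the trace *)

Section Log.
Context {R : realType}.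
Implicit Types A B U : 'M[R]_3.

Lemma rotation_trmx p (U : 'M[R]_p) : rotation U -> rotation U^T.
Proof. by move=> [UU dU]; split; rewrite ?det_tr // trmxK; exact: mulmx1C. Qed.

Lemma rotationM p (U V : 'M[R]_p) : rotation U -> rotation V -> rotation (U *m V).
Proof.
move=> [UU dU] [VV dV]; split; last by rewrite det_mulmx dU dV mulr1.
by rewrite trmx_mul mulmxA -(mulmxA U) VV mulmx1.
Qed.

(** The angle is acos x up to a sign chosen to match y. Recording its square suffices both for
    Frobenius norms and for the bound |t| <= pi. *)
Lemma circle_angle (x y : R) : x ^+ 2 + y ^+ 2 = 1 ->
  exists t, [/\ t ^+ 2 = acos x ^+ 2, cos t = x & sin t = y].
Proof.
move=> xy; have x1 : -1 <= x <= 1 by apply/andP; split; nra.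
have ax : cos (acos x) = x by rewrite acosK // in_itv.
have sy : sin (acos x) ^+ 2 = y ^+ 2 by rewrite sin2cos2 ax -xy addrC addKr.
have := eqf_sqr (sin (acos x)) y; rewrite sy eqxx => /esym/orP[]/eqP s.
  by exists (acos x).
by exists (- acos x); rewrite sqrrN cosN sinN s opprK.
Qed.

Lemma special_orthogonal2 (p q r s : R) : p ^+ 2 + q ^+ 2 = 1 ->
  p * r + q * s = 0 -> p * s - q * r = 1 -> s = p /\ r = - q.
Proof.
move=> pq pqrs dt; split.
  transitivity (p * (p * s - q * r) + q * (p * r + q * s)).
    by rewrite -[LHS]mulr1 -pq; ring.
  by rewrite pqrs dt; ring.
transitivity (p * (p * r + q * s) - q * (p * s - q * r)).
  by rewrite -[LHS]mulr1 -pq; ring.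
by rewrite pqrs dt; ring.
Qed.

(** Euler's theorem: 1 is an eigenvalue, and once the axis is moved to the third basis vector the
    remaining 2 x 2 block is a planar rotation. [Q] is merely orthogonal and may reverse the sense
    of rotation, which the square of t does not see. *)
Lemma euler_rotation U : rotation U ->
  exists Q t, [/\ Q *m Q^T = 1%:M, U = Q^T *m rotz t *m Q &
                  t ^+ 2 = rotangle U ^+ 2].
Proof.
move=> [UU dU].
have /eqP/det0P[v v0 vU] : \det (U - 1%:M) = 0.
  (* U - 1 = U (1 - U^T), and a change of sign negates the determinant in dimension 3. *)
  have : \det (U - 1%:M) = - \det (U - 1%:M).
    rewrite -{1}UU -[U in U - _]mulmx1 -mulmxBr det_mulmx dU mul1r.
    rewrite -det_tr linearB /= trmx1 trmxK -opprB -scaleN1r detZ.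
    by rewrite -signr_odd expr1 mulN1r.
  by move=> h; lra.
have {vU}vU : v *m U = v.
  by apply/eqP; rewrite -subr_eq0 -{2}[v]mulmx1 -mulmxBr vU.
have [b b0 bv] := unit_row_multiple v0.
have ee : (delta_mx 0 o2 : 'rV[R]_3) *m (delta_mx 0 o2)^T = 1%:M.
  by rewrite trmx_delta mul_delta_mx; apply/matrixP => i j; rewrite !ord1 !mxE.
have [Q QQ eQ] := orthogonal_moving_row ee bv.
have QQ' := mulmx1C QQ.
have [M MQ] : exists M : 'M[R]_3, M = Q *m U *m Q^T by eexists.
have UM : U = Q^T *m M *m Q.
  by rewrite MQ !mulmxA QQ' mul1mx -mulmxA QQ' mulmx1.
have MM : M *m M^T = 1%:M.
  rewrite MQ !trmx_mul trmxK !mulmxA -(mulmxA _ Q^T) QQ' mulmx1.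
  by rewrite -(mulmxA Q) UU mulmx1.
have dM : \det M = 1.
  by rewrite MQ !det_mulmx mulrAC -det_mulmx QQ det1 mul1r.
have eM : delta_mx (0 : 'I_1) o2 *m M = delta_mx 0 o2.
  by rewrite MQ !mulmxA eQ -scalemxAl vU -eQ -mulmxA QQ mulmx1.
have trM : \tr M = \tr U.
  by rewrite MQ mxtrace_mulC mulmxA QQ' mul1mx.
have M2 j : M o2 j = (j == o2)%:R.
  by move/matrixP: eM => /(_ 0 j); rewrite -rowE !mxE eqxx.
clear MQ eM; have Mx := mx3E M; rewrite !M2 /= in Mx.
move: MM dM; rewrite Mx trmx3 mulmx3 [X in _ = X -> _]scalar_mx3 det3.
set p := M o0 o0; set q := M o0 o1; set r := M o0 o2.
set s := M o1 o0; set t := M o1 o1; set u := M o1 o2.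
move=> /matrixP MM dM.
have := MM o0 o2; rewrite !mxE /= => r0; have {}r0 : r = 0 by lra.
have := MM o1 o2; rewrite !mxE /= => u0; have {}u0 : u = 0 by lra.
have := MM o0 o0; rewrite !mxE /= r0 => pq.
have := MM o0 o1; rewrite !mxE /= r0 u0 => pqst.
have {MM}pq : p ^+ 2 + q ^+ 2 = 1 by rewrite -pq; ring.
have {}pqst : p * s + q * t = 0 by rewrite -pqst; ring.
have {}dM : p * t - q * s = 1 by rewrite -dM r0 u0; ring.
have [tp sq] := special_orthogonal2 pq pqst dM.
have [w [wa cw sw]] := circle_angle pq.
(* The angle w was read off the first row (p, q), whereas the first row of [rotz w] carries - sin
   w. *)
exists Q, (- w); split=> //.
  rewrite UM Mx -/p -/q -/r -/s -/t -/u rotzN rotzE trmx3 r0 u0 sq tp cw sw //.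
rewrite sqrrN wa /rotangle -trM mxtrace3 -/p -/t M2 /= tp.
by congr (acos _ ^+ 2); field.
Qed.

(** Conjugating the planar generator gives an explicit logarithm of any rotation in Euler's form,
    which meets the lower bound [rotangle_le_log] when t is plus or minus the rotation angle. *)
Lemma expmx_conj_rotz (Q : 'M[R]_3) t : Q *m Q^T = 1%:M ->
  let E := Q^T *m mx3 0 (- t) 0 t 0 0 0 0 0 *m Q in
  [/\ E^T = - E, expmx E = Q^T *m rotz t *m Q & frobenius E ^+ 2 = 2 * t ^+ 2].
Proof.
move=> QQ; have QQ' := mulmx1C QQ.
set T := mx3 _ _ _ _ _ _ _ _ _ => E.
have conjM A B : (Q^T *m A *m Q) *m (Q^T *m B *m Q) = Q^T *m (A *m B) *m Q.
  by rewrite !mulmxA -[_ *m Q *m Q^T]mulmxA QQ mulmx1.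
have Et : E^T = - E.
  have Tt : T^T = - T.
    by rewrite -scaleN1r /T trmx3 scalemx3; congr mx3; ring.
  by rewrite !trmx_mul trmxK Tt mulNmx mulmxN mulmxA.
have EE : frobenius E ^+ 2 = 2 * t ^+ 2.
  rewrite frobenius_sqr Et mulmxN linearN /= conjM (mxtrace_mulC _ Q).
  rewrite (mulmxA Q) QQ mul1mx.
  by rewrite mulmx3 mxtrace3 !mxE /=; ring.
split=> //; have [t0|t0] := eqVneq t 0.
  have -> : E = 0.
    rewrite /E (_ : T = 0) ?mulmx0 ?mul0mx //.
    by rewrite [RHS]mx3E /T t0 oppr0; congr mx3; rewrite mxE.
  rewrite expmx0 (_ : rotz t = 1%:M) ?mulmx1 ?QQ' //.
  by rewrite rotzE t0 cos0 sin0 oppr0 scalar_mx3.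
rewrite (expmx_rodrigues t0); last first.
  by rewrite skew_cube // EE; congr (_ *: _); field.
have conjZ a A : a *: (Q^T *m A *m Q) = Q^T *m (a *: A) *m Q.
  by rewrite -scalemxAr -scalemxAl.
have conj1 : 1%:M = Q^T *m 1%:M *m Q by rewrite mulmx1.
rewrite conjM !conjZ [X in X + _ + _]conj1 -2!mulmxDl -2!mulmxDr.
congr (_ *m _ *m _); rewrite mulmx3 !scalemx3 scalar_mx3 !addmx3 rotzE.
by congr mx3; field.
Qed.

(** The explicit logarithm attains the lower bound, so a minimal one exists and the default value of
    [xget] never arises on rotations. *)
Lemma log_rotP U : rotation U -> is_log_rot U (log_rot U).
Proof.
move=> rU; apply: xgetPex; have [Q [t [QQ -> tU]]] := euler_rotation rU.
have [Et Ee EE] := expmx_conj_rotz t QQ.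
exists (Q^T *m mx3 0 (- t) 0 t 0 0 0 0 0 *m Q); split=> // B Bt Be.
rewrite -(@ler_pXn2r _ 2) ?nnegrE ?sqrtr_ge0 // EE.
by apply: le_trans (rotangle_le_log Bt); rewrite Be tU.
Qed.

Lemma frobenius_log_rot U : rotation U ->
  frobenius (log_rot U) ^+ 2 = 2 * rotangle U ^+ 2.
Proof.
move=> rU; have [At Ae Amin] := log_rotP rU; apply/eqP; rewrite eq_le.
have -> /= : 2 * rotangle U ^+ 2 <= frobenius (log_rot U) ^+ 2.
  by rewrite -{1}Ae rotangle_le_log.
rewrite andbT.
have [Q [t [QQ UQ tU]]] := euler_rotation rU.
have [Et Ee EE] := expmx_conj_rotz t QQ.
rewrite -tU -EE ler_pXn2r ?nnegrE ?sqrtr_ge0 //.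
by apply: Amin; rewrite ?Ee.
Qed.

Lemma rotation_trace_bounds U : rotation U -> -1 <= (\tr U - 1) / 2 <= 1.
Proof.
move=> rU; have [Q [t [QQ -> _]]] := euler_rotation rU.
rewrite mxtrace_mulC mulmxA QQ mul1mx rotzE mxtrace3 !mxE /=.
by rewrite (_ : (_ - 1) / 2 = cos t) ?cos_geN1 ?cos_le1 //; field.
Qed.

Lemma rotangle_ge0 U : rotation U -> 0 <= rotangle U.
Proof. by move=> /rotation_trace_bounds; exact: acos_ge0. Qed.

(** Cosine decreases on [0, pi], so a smaller angle means a larger trace. *)
Lemma le_rotangle U V : rotation U -> rotation V ->
  (rotangle U <= rotangle V) = (\tr V <= \tr U).
Proof.
move=> rU rV; have bU := rotation_trace_bounds rU.
have bV := rotation_trace_bounds rV.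
have ac (W : 'M[R]_3) : -1 <= (\tr W - 1) / 2 <= 1 ->
    rotangle W \in `[0, pi] /\ cos (rotangle W) = (\tr W - 1) / 2.
  by move=> bW; rewrite in_itv /= acos_ge0 ?acos_lepi ?acosK.
have [iU cU] := ac _ bU; have [iV cV] := ac _ bV.
rewrite leNgt -(ltr_cos iV iU) cU cV -leNgt.
by rewrite ler_pM2r ?invr_gt0 // lerD2r.
Qed.

End Log.

(** * Versions, signed permutations and the invariance of the distance *)

Section Versions.
Context {R : realType}.

Lemma diagPosP p (D : 'M[R]_p) : diagPos D ->
  exists2 d, D = diag_mx d & forall i, 0 < d 0 i.
Proof.
move=> [/diag_mxP[d ->] dpos]; exists d => // i.
by have := dpos i; rewrite mxE eqxx.
Qed.

Lemma diagPos_diag_mx p (d : 'rV[R]_p) :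
  (forall i, 0 < d 0 i) -> diagPos (diag_mx d).
Proof.
move=> dpos; split; first by apply/diag_mxP; exists d.
by move=> i; rewrite mxE eqxx mulr1n.
Qed.

Lemma char_poly_diag_mx p (d : 'rV[R]_p) :
  char_poly (diag_mx d) = \prod_i ('X - (d 0 i)%:P).
Proof.
rewrite char_poly_trig ?diag_mx_is_trig //.
by apply: eq_bigr => i _; rewrite mxE eqxx.
Qed.

Lemma char_poly_version p (X U : 'M[R]_p) d :
  versions X (U, diag_mx d) -> char_poly X = \prod_i ('X - (d 0 i)%:P).
Proof. by move=> [/= [UU _] _ ->]; rewrite char_poly_conj // char_poly_diag_mx. Qed.

Lemma prod_XsubC_perm p (d e : 'rV[R]_p) :
  \prod_i ('X - (d 0 i)%:P) = \prod_i ('X - (e 0 i)%:P) ->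
  exists s : 'S_p, e = \row_i d 0 (s i).
Proof.
have tE (f : 'rV[R]_p) : \prod_i ('X - (f 0 i)%:P) =
    \prod_(a <- [tuple f 0 i | i < p]) ('X - a%:P).
  by rewrite /= big_map big_enum.
rewrite !tE => /prod_XsubC_eq; rewrite perm_sym => /tuple_permP[s es].
exists s; apply/rowP => i; rewrite mxE.
have : tnth [tuple e 0 i | i < p] i =
    tnth [tuple tnth [tuple d 0 i | i < p] (s i) | i < p] i.
  by congr tnth; apply: val_inj.
by rewrite !tnth_mktuple.
Qed.

Lemma version_eigenvalues p (X U V : 'M[R]_p) d e :
  versions X (U, diag_mx d) -> versions X (V, diag_mx e) ->
  exists s : 'S_p, e = \row_i d 0 (s i).
Proof.
by move=> /char_poly_version dX /char_poly_version; rewrite dX => /prod_XsubC_perm.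
Qed.

Lemma rotation_diag_sqr p (g : 'rV[R]_p) :
  rotation (diag_mx g) -> forall i, g 0 i ^+ 2 = 1.
Proof.
move=> [/matrixP gg _] i; have := gg i i.
by rewrite tr_diag_mx mulmx_diag !mxE eqxx expr2.
Qed.

Lemma rotation_rperm s : rotation (rperm_mx s : 'M[R]_3).
Proof.
(* [perm_mx] has the 1 of row i in column s i, [perm0_mx] that of column i in row s i. *)
have P0 : perm0_mx s = (perm_mx s)^T :> 'M[R]_3.
  by apply/matrixP => i j; rewrite !mxE eq_sym.
have PP : (perm_mx s)^T *m ((perm_mx s)^T)^T = 1%:M :> 'M[R]_3.
  by rewrite trmxK tr_perm_mx -perm_mxM mulVg perm_mx1.
rewrite /rperm_mx P0; case: ifPn => [/eqP dP | dP]; first by split.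
split.
  rewrite trmx_mul mulmxA -(mulmxA (diag3 _ _ _)) PP mulmx1 tr_diag_mx mulmx_diag.
  rewrite -diag_const_mx; congr diag_mx; apply/rowP => i; rewrite !mxE.
  by elim/forall_ord3: i => /=; ring.
rewrite det_mulmx det_diag det_tr det_perm !big_ord_recl big_ord0 !mxE /=.
move: dP; rewrite det_tr det_perm.
by case: (odd_perm s); rewrite ?expr0 ?eqxx // expr1 => _; ring.
Qed.

(** Whichever branch of [rperm_mx] is taken, the result is a permutation matrix up to row signs;
    these square to 1 and so disappear on conjugating a diagonal matrix. *)
Lemma rperm_sign s : exists2 e : 'rV[R]_3,
  rperm_mx s = diag_mx e *m (perm_mx s)^T & forall i, e 0 i ^+ 2 = 1.
Proof.
have P0 : perm0_mx s = (perm_mx s)^T :> 'M[R]_3.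
  by apply/matrixP => i j; rewrite !mxE eq_sym.
rewrite /rperm_mx P0; case: ifP => _.
  exists (const_mx 1) => [|i]; last by rewrite mxE expr1n.
  by rewrite diag_const_mx mul1mx.
exists (row3 (-1) 1 1) => // i; rewrite mxE.
by elim/forall_ord3: i => /=; ring.
Qed.

Lemma diag_act_diag_mx (d : 'rV[R]_3) s :
  diag_act (diag_mx d) s = diag_mx (\row_i d 0 ((s^-1)%g i)).
Proof.
rewrite /diag_act; have [e -> e2] := rperm_sign s.
rewrite trmx_mul trmxK tr_diag_mx !mulmxA -2!(mulmxA (diag_mx e)).
have -> : (perm_mx s)^T *m diag_mx d *m perm_mx s =
    diag_mx (\row_i d 0 ((s^-1)%g i)).
  rewrite tr_perm_mx -row_permE -[s in perm_mx s]invgK -col_permE.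
  by apply/matrixP => i j; rewrite !mxE (inj_eq perm_inj).
rewrite !mulmx_diag; congr diag_mx; apply/rowP => i; rewrite !mxE.
by rewrite mulrAC -expr2 e2 mul1r.
Qed.

Lemma signed_perm_conj (s : 'S_3) (g d : 'rV[R]_3) : rotation (diag_mx g) ->
  let H := rperm_mx s *m diag_mx g in
  H^T *m diag_mx d *m H = diag_mx (\row_i d 0 (s i)).
Proof.
move=> rg H; have [PP _] := rotation_rperm s; have PP' := mulmx1C PP.
have PdP : (rperm_mx s)^T *m diag_mx d *m rperm_mx s = diag_mx (\row_i d 0 (s i)).
  have -> : diag_mx d = diag_act (diag_mx (\row_i d 0 (s i))) s.
    by rewrite diag_act_diag_mx; congr diag_mx; apply/rowP => i; rewrite !mxE permKV.
  by rewrite /diag_act !mulmxA PP' mul1mx -mulmxA PP' mulmx1.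
rewrite /H trmx_mul tr_diag_mx !mulmxA -2!(mulmxA (diag_mx g)) PdP.
rewrite !mulmx_diag; congr diag_mx; apply/rowP => i; rewrite !mxE.
by rewrite mulrAC -expr2 rotation_diag_sqr // mul1r.
Qed.

Lemma versions_realign p (X U D H : 'M[R]_p) : rotation H ->
  diagPos (H^T *m D *m H) -> versions X (U, D) ->
  versions X (U *m H, H^T *m D *m H).
Proof.
move=> rH pD [/= rU _ ->]; split=> //=; first exact: rotationM.
have [HH _] := rH.
by rewrite trmx_mul !mulmxA -[U *m H *m _]mulmxA HH mulmx1 -(mulmxA _ H) HH mulmx1.
Qed.

Lemma frobenius_log_diag p (D : 'M[R]_p) :
  frobenius (log_diag D) ^+ 2 = \sum_i ln (D i i) ^+ 2.
Proof.
rewrite sqr_sqrtr; last first.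
  by rewrite sumr_ge0 // => i _; rewrite sumr_ge0 // => j _; exact: sqr_ge0.
apply: eq_bigr => i _; rewrite (bigD1 i) //= big1 ?addr0 ?mxE ?eqxx ?mxE //.
by move=> j ji; rewrite mxE eq_sym (negPf ji) expr0n.
Qed.

Lemma invmx_diag p (d : 'rV[R]_p) : (forall i, d 0 i != 0) ->
  invmx (diag_mx d) = diag_mx (\row_i (d 0 i)^-1).
Proof.
move=> d0; have dd : diag_mx d *m diag_mx (\row_i (d 0 i)^-1) = 1%:M.
  rewrite mulmx_diag -diag_const_mx; congr diag_mx.
  by apply/rowP => i; rewrite !mxE mulfV.
have [du _] := mulmx1_unit dd.
by rewrite -[LHS]mulmx1 -dd mulKmx.
Qed.

Lemma log_diag_ratio p (d l : 'rV[R]_p) : (forall i, 0 < d 0 i) ->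
  frobenius (log_diag (diag_mx l *m invmx (diag_mx d))) ^+ 2 =
  \sum_i ln (l 0 i / d 0 i) ^+ 2.
Proof.
move=> d0; rewrite frobenius_log_diag invmx_diag => [|i]; last by rewrite gt_eqF.
by apply: eq_bigr => i _; rewrite mulmx_diag !mxE eqxx.
Qed.

(** The rotational part depends only on V U^T, where H H^T cancels; the sum of squared logarithms is
    merely reindexed by s. *)
Lemma geo_dist_realign (k : R) (U V : 'M[R]_3) (d l : 'rV[R]_3) s g :
  (forall i, 0 < d 0 i) -> rotation (diag_mx g) ->
  let H := rperm_mx s *m diag_mx g in
  geo_dist k (U *m H, H^T *m diag_mx d *m H) (V *m H, H^T *m diag_mx l *m H) =
  geo_dist k (U, diag_mx d) (V, diag_mx l).
Proof.
move=> d0 rg H; have [HH _] : rotation H.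
  by apply: rotationM => //; exact: rotation_rperm.
have dH i : 0 < (\row_i d 0 (s i)) 0 i by rewrite mxE.
have Hd := signed_perm_conj s d rg; have Hl := signed_perm_conj s l rg.
rewrite -/H in Hd Hl; rewrite Hd Hl /geo_dist /=.
rewrite trmx_mul mulmxA -(mulmxA V) HH mulmx1.
rewrite (log_diag_ratio l d0) (log_diag_ratio _ dH).
congr (Num.sqrt (_ + _)); rewrite [RHS](reindex_perm s) /=.
by apply: eq_bigr => i _; rewrite !mxE.
Qed.

Lemma geo_distE (k : R) (U V : 'M[R]_3) (d l : 'rV[R]_3) :
  rotation U -> rotation V -> (forall i, 0 < d 0 i) ->
  geo_dist k (U, diag_mx d) (V, diag_mx l) =
  Num.sqrt (k * rotangle (V *m U^T) ^+ 2 + \sum_i ln (l 0 i / d 0 i) ^+ 2).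
Proof.
move=> rU rV d0; rewrite /geo_dist /= log_diag_ratio // frobenius_log_rot.
  by congr (Num.sqrt (_ + _)); field.
by apply: rotationM => //; exact: rotation_trmx.
Qed.

(** The diagonal terms agree and k is positive, so only the angles are compared, and these are
    ordered inversely to the traces. *)
Lemma le_geo_dist (k : R) (U V U' V' : 'M[R]_3) (d l : 'rV[R]_3) : 0 < k ->
  rotation U -> rotation V -> rotation U' -> rotation V' ->
  (forall i, 0 < d 0 i) ->
  (geo_dist k (U, diag_mx d) (V, diag_mx l) <=
   geo_dist k (U', diag_mx d) (V', diag_mx l)) =
  (\tr (V' *m U'^T) <= \tr (V *m U^T)).
Proof.
move=> k0 rU rV rU' rV' d0; rewrite !geo_distE //.
have rVU : rotation (V *m U^T) by apply: rotationM => //; exact: rotation_trmx.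
have rVU' : rotation (V' *m U'^T) by apply: rotationM => //; exact: rotation_trmx.
rewrite ler_sqrt; last first.
  apply: addr_ge0; first by apply: mulr_ge0; [exact: ltW | exact: sqr_ge0].
  by apply: sumr_ge0 => i _; exact: sqr_ge0.
by rewrite lerD2r ler_pM2l // ler_pXn2r ?nnegrE ?rotangle_ge0 // le_rotangle.
Qed.

(** The rotation is W = U^T V P_s; it commutes with the diagonal matrix because both factorizations
    give the same X. *)
Lemma versions_frame (X U V : 'M[R]_3) d s :
  versions X (U, diag_mx d) -> versions X (V, diag_act (diag_mx d) s) ->
  exists W, [/\ rotation W, W *m diag_mx d = diag_mx d *m W &
                V = U *m W *m (rperm_mx s)^T].
Proof.
move=> [/= rU _ XU] [/= rV _ XV]; have [UU _] := rU; have UU' := mulmx1C UU.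
have [VV _] := rV; have VV' := mulmx1C VV.
have rP := rotation_rperm s; have [PP _] := rP; have PP' := mulmx1C PP.
exists (U^T *m V *m rperm_mx s); split.
- by apply: rotationM => //; apply: rotationM => //; exact: rotation_trmx.
(* Expanding X by the second version on the left and by the first on the right turns this identity
   into W D = D W. *)
- have : U^T *m X *m V *m rperm_mx s = U^T *m X *m V *m rperm_mx s by [].
  rewrite {1}XV /diag_act XU !mulmxA UU' mul1mx.
  rewrite -(mulmxA _ V^T) VV' mulmx1 -(mulmxA _ (rperm_mx s)^T) PP' mulmx1 //.
- by rewrite !mulmxA UU mul1mx -mulmxA PP mulmx1.
Qed.

End Versions.

(** * Rotations commuting with a diagonal matrix *)

Section Stabilizers.
Context {R : realType}.

Lemma commute_diag_mx p (W : 'M[R]_p) (d : 'rV[R]_p) i j :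
  W *m diag_mx d = diag_mx d *m W -> d 0 i != d 0 j -> W i j = 0.
Proof.
rewrite mul_diag_mx mul_mx_diag => /matrixP/(_ i j); rewrite !mxE => Wd dij.
have /eqP : W i j * (d 0 i - d 0 j) = 0 by rewrite mulrBr Wd mulrC subrr.
by rewrite mulf_eq0 subr_eq0 (negPf dij) orbF => /eqP.
Qed.

Lemma commute_diag_inj p (W : 'M[R]_p) (d : 'rV[R]_p) : injective (d 0) ->
  W *m diag_mx d = diag_mx d *m W -> W = diag_mx (\row_i W i i).
Proof.
move=> dI Wd; apply/matrixP => i j; rewrite !mxE.
have [->|ij] := eqVneq i j; first by rewrite mulr1n.
by rewrite mulr0n (commute_diag_mx Wd) // (inj_eq dI).
Qed.

Lemma rotation_sigmas j : rotation (diag_mx (sigmas j : 'rV[R]_3)).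
Proof.
split.
  rewrite tr_diag_mx mulmx_diag -diag_const_mx; congr diag_mx.
  apply/rowP => i; rewrite !mxE.
  by case: j => -[|[|//]] ?; elim/forall_ord3: i; rewrite /sigmas /= !mxE /=; ring.
rewrite det_diag !big_ord_recl big_ord0.
by case: j => -[|[|//]] ?; rewrite /sigmas /= !mxE /=; ring.
Qed.

Lemma diag3E (a b c : R) : diag3 a b c = mx3 a 0 0 0 b 0 0 0 c.
Proof. by rewrite [LHS]mx3E; congr mx3; rewrite !mxE. Qed.

(** W is a 2 x 2 orthogonal block and a corner entry 1 or -1. In the first case the block is a
    planar rotation; in the second it is a reflection, hence a planar rotation times diag(-1, 1). *)
Lemma commute_diag3_rotz (W : 'M[R]_3) a c : a != c -> rotation W ->
  W *m diag3 a a c = diag3 a a c *m W ->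
  exists t j, W = rotz t *m diag_mx (sigmas j).
Proof.
move=> ac [WW dW] Wd.
have W0 (i j : 'I_3) : row3 a a c 0 i != row3 a a c 0 j -> W i j = 0.
  by move=> ij; apply: commute_diag_mx ij.
have Wx := mx3E W.
rewrite (W0 o0 o2) ?(W0 o1 o2) ?(W0 o2 o0) ?(W0 o2 o1) in Wx; last by rewrite !mxE.
all: rewrite ?mxE //= ?(eq_sym c) //.
move: WW dW; rewrite Wx trmx3 mulmx3 [X in _ = X -> _]scalar_mx3 det3.
set p := W o0 o0; set q := W o0 o1; set r := W o1 o0; set s := W o1 o1.
set e := W o2 o2 => /matrixP WW dW.
have := WW o0 o0; rewrite !mxE /= => h.
have pq : p ^+ 2 + q ^+ 2 = 1 by rewrite -h; ring.
have := WW o0 o1; rewrite !mxE /= => h'.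
have pqrs : p * r + q * s = 0 by rewrite -h'; ring.
have := WW o2 o2; rewrite !mxE /= => {h h'}h.
have /eqP : e ^+ 2 = 1 by rewrite -h; ring.
have {}dW : e * (p * s - q * r) = 1 by rewrite -dW; ring.
rewrite sqrf_eq1 => /orP[]/eqP e1; rewrite e1 in dW.
  have [sp rq] := special_orthogonal2 pq pqrs (etrans (esym (mul1r _)) dW).
  have [|t [_ ct st]] := @circle_angle _ p r; first by rewrite rq sqrrN.
  exists t, ord0; rewrite (_ : diag_mx _ = 1%:M) ?mulmx1; last first.
    by rewrite -/(diag3 1 1 1) diag3E scalar_mx3.
  by rewrite [RHS]rotzE ct st -/p -/q -/r -/s -/e e1 sp rq opprK.
(* The block has determinant -1 here, so its second row is negated to reach determinant 1. *)
have [||sp rq] := @special_orthogonal2 _ p q (- r) (- s) pq.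
- by rewrite !mulrN -opprD pqrs oppr0.
- by rewrite -dW; ring.
have [|t [_ ct st]] := @circle_angle _ (- p) (- q); first by rewrite !sqrrN.
exists t, ord_max; rewrite rotzE -/(diag3 (-1) 1 (-1)) diag3E mulmx3 ct st.
have {sp}sp : s = - p by rewrite -sp opprK.
have {rq}rq : r = q by apply: oppr_inj.
by rewrite -/p -/q -/r -/s -/e e1 sp rq; congr mx3; ring.
Qed.

Lemma rotz_block (t : R) : rotz t =
  block_mx (\matrix_(i < 2, j < 2) rotz t (lshift 1 i) (lshift 1 j))
    0 0 (1%:M : 'M[R]_1) :> 'M[R]_(2 + 1).
Proof.
apply/matrixP => i j.
case: (@split_ordP 2 1 i) => i' ->; case: (@split_ordP 2 1 j) => j' ->.
- by rewrite block_mxEul [RHS]mxE.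
- by rewrite block_mxEur !mxE !ord1 /=; case: i' => -[|[|//]] ?.
- by rewrite block_mxEdl !mxE !ord1 /=; case: j' => -[|[|//]] ?.
- by rewrite block_mxEdr !mxE !ord1.
Qed.

(** Identifying SO(2) with the circle turns the minimal rotation into an extremum over one angle. *)
Lemma block_rotP (B : 'M[R]_3) : block_rot B <-> exists t, B = rotz t.
Proof.
split=> [[B11 [BB dB] ->]|[t ->]].
  have /matrixP E := BB; have := E 0 0; have := E 0 1.
  rewrite det2 in dB; move: dB; rewrite !mxE !big_ord_recl !big_ord0 !mxE /=.
  have -> : lift ord0 ord0 = 1 :> 'I_2 by exact: val_inj.
  have -> : ord0 = 0 :> 'I_2 by exact: val_inj.
  set p := B11 0 0; set q := B11 0 1; set r := B11 1 0; set s := B11 1 1.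
  rewrite !addr0 => dB pqrs pq; rewrite -!expr2 in pq.
  have [sp rq] := special_orthogonal2 pq pqrs dB.
  have [|t [_ ct st]] := @circle_angle _ p r; first by rewrite rq sqrrN.
  exists t; rewrite [RHS]rotz_block.
  suff -> : B11 = \matrix_(i < 2, j < 2) rotz t (lshift 1 i) (lshift 1 j) by [].
  apply/matrixP => i j.
  have e01 (k : 'I_2) : k = 0 \/ k = 1.
    by case: k => -[|[|//]] ?; [left | right]; exact: val_inj.
  case: (e01 i) => ->; case: (e01 j) => ->; rewrite !mxE /= ?ct ?st //.
  by rewrite rq opprK.
exists (\matrix_(i < 2, j < 2) rotz t (lshift 1 i) (lshift 1 j));
  last exact: rotz_block.
have cs : cos t * cos t + sin t * sin t = 1 by rewrite -!expr2 cos2Dsin2.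
split; last by rewrite det2 !mxE /= -[RHS]cs; ring.
apply/matrixP => -[[|[|//]] ?] -[[|[|//]] ?].
all: rewrite !mxE !big_ord_recl big_ord0 !mxE /=.
all: first [ring | rewrite -[RHS]cs; ring].
Qed.

Lemma rotz_commute_diag3 t (a c : R) :
  rotz t *m diag3 a a c = diag3 a a c *m rotz t.
Proof. by rewrite rotzE diag3E !mulmx3; congr mx3; ring. Qed.

(** Reduction modulo a full turn, obtained from arccosine; it confines the angles to a compact
    interval. *)
Lemma rotz_bounded (t : R) : exists2 u, - pi <= u <= pi & rotz t = rotz u.
Proof.
have [u [ua cu su]] := circle_angle (cos2Dsin2 t).
exists u; last by rewrite !rotzE cu su.
rewrite -ler_norml -(@ler_pXn2r _ 2) ?nnegrE ?pi_ge0 //.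
rewrite real_normK ?num_real // ua ler_pXn2r ?nnegrE ?pi_ge0 ?acos_ge0 ?acos_lepi //.
all: by rewrite ?cos_geN1 ?cos_le1.
Qed.

End Stabilizers.

(** * Attained minima and maxima *)

Section Extrema.
Context {R : realType}.

Lemma min_ord_le n (F : 'I_n.+1 -> R) i : min_ord F <= F i.
Proof. exact: bigmin_le. Qed.

Lemma min_ord_attained n (F : 'I_n.+1 -> R) : exists i, min_ord F = F i.
Proof.
apply: (big_ind (fun x => exists i, x = F i)) => [|x y [i ->] [j ->]|i _].
- by exists ord0.
- by case: (leP (F i) (F j)) => _; [exists i | exists j].
- by exists i.
Qed.

(** Each formula for the distance is reached in this way, as a lower bound attained by a pair of
    versions. *)
Lemma sr_distE k (X Y : 'M[R]_3) m :
  (exists UD VL, [/\ versions X UD, versions Y VL & m = geo_dist k UD VL]) ->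
  (forall UD VL, versions X UD -> versions Y VL -> m <= geo_dist k UD VL) ->
  sr_dist k X Y = m.
Proof.
move=> mS mlb; rewrite /sr_dist; set S := (X in inf X); apply/eqP; rewrite eq_le.
have Slb : lbound S m by move=> _ [UD [VL [vX vY ->]]]; exact: mlb.
apply/andP; split; first by apply: ge_inf => //; exists m.
by apply: lb_le_inf => //; exists m.
Qed.

Lemma continuous_square_max (f : R * R -> R) : continuous f ->
  exists t u, forall t' u', - pi <= t' <= pi -> - pi <= u' <= pi ->
    f (t', u') <= f (t, u).
Proof.
move=> cf; pose I := `[- pi, pi]%classic : set R.
have IP x : - pi <= x <= pi -> I x by move=> xI; rewrite /I /= in_itv.
have cI : compact (I `*` I) by apply: compact_setX; exact: segment_compact.
have I0 : I `*` I !=set0.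
  by exists (0, 0); split; apply: IP; rewrite oppr_le0 pi_ge0.
have [|[t u] _ tu] := compact_EVT_max I0 cI (f := f).
  exact: continuous_subspaceT.
exists t, u => t' u' tI uI; by apply: tu; rewrite inE; split; exact: IP.
Qed.

Lemma rotz_decomposition (t : R) : rotz t =
  mx3 0 0 0 0 0 0 0 0 1 + cos t *: mx3 1 0 0 0 1 0 0 0 0
  + sin t *: mx3 0 (-1) 0 1 0 0 0 0 0.
Proof. by rewrite !scalemx3 !addmx3 rotzE; congr mx3; ring. Qed.

(** [rotz t] is affine in cos t and sin t, so f becomes a polynomial in the cosines and sines of two
    angles, hence continuous; angles in [- pi, pi] reach every value, and a compact square has a
    maximum. *)
Lemma bilinear_rotz_max (f : 'M[R]_3 -> 'M[R]_3 -> R) :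
  (forall A, linear (f A : 'M[R]_3 -> R^o)) ->
  (forall B, linear (f^~ B : 'M[R]_3 -> R^o)) ->
  exists t u, forall t' u', f (rotz t') (rotz u') <= f (rotz t) (rotz u).
Proof.
move=> flin flin'.
have fD A B C : f A (B + C) = f A B + f A C.
  by have := flin A 1 B C; rewrite !scale1r.
have fZ A a B : f A (a *: B) = a * f A B.
  have f0 : f A 0 = 0 by apply: (addrI (f A 0)); rewrite -fD !addr0.
  by have := flin A a B 0; rewrite !addr0 f0 addr0.
have f'D A B C : f (B + C) A = f B A + f C A.
  by have := flin' A 1 B C; rewrite !scale1r.
have f'Z A a B : f (a *: B) A = a * f B A.
  have f0 : f 0 A = 0 by apply: (addrI (f 0 A)); rewrite -f'D !addr0.
  by have := flin' A a B 0; rewrite !addr0 f0 addr0.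
have [|t [u tu]] := continuous_square_max (f := fun x => f (rotz x.1) (rotz x.2)).
  pose K := mx3 0 0 0 0 0 0 0 0 (1 : R); pose C := mx3 1 0 0 0 1 0 0 0 (0 : R).
  pose S := mx3 0 (-1) 0 1 0 0 0 0 (0 : R).
  rewrite (_ : (fun x => _) = fun x : R * R =>
    f K K + cos x.1 * f C K + sin x.1 * f S K
    + cos x.2 * (f K C + cos x.1 * f C C + sin x.1 * f S C)
    + sin x.2 * (f K S + cos x.1 * f C S + sin x.1 * f S S)); last first.
    apply/funext => x; rewrite 2!rotz_decomposition !(fD, f'D, fZ, f'Z) -/K -/C -/S.
    by ring.
  have c1 : continuous (fun x : R * R => cos x.1).
    by move=> x; apply: continuous_comp; [exact: cvg_fst | exact: continuous_cos].
  have c2 : continuous (fun x : R * R => cos x.2).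
    by move=> x; apply: continuous_comp; [exact: cvg_snd | exact: continuous_cos].
  have s1 : continuous (fun x : R * R => sin x.1).
    by move=> x; apply: continuous_comp; [exact: cvg_fst | exact: continuous_sin].
  have s2 : continuous (fun x : R * R => sin x.2).
    by move=> x; apply: continuous_comp; [exact: cvg_snd | exact: continuous_sin].
  have cD (g h : R * R -> R) :
      continuous g -> continuous h -> continuous (fun x => g x + h x).
    by move=> cg ch x; apply: cvgD; [exact: cg | exact: ch].
  have cM (g h : R * R -> R) :
      continuous g -> continuous h -> continuous (fun x => g x * h x).
    by move=> cg ch x; apply: cvgM; [exact: cg | exact: ch].
  have cC (a : R) : continuous (fun _ : R * R => a) by move=> x; exact: cvg_cst.
  do ![exact: cC | exact: c1 | exact: c2 | exact: s1 | exact: s2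
    | refine (cM _ _ _ _) | refine (cD _ _ _ _)].
exists t, u => t' u'; have [a aI ->] := rotz_bounded t'.
by have [b bI ->] := rotz_bounded u'; exact: tu.
Qed.

End Extrema.

(** * Existence and enumeration of versions, and the reduction to a fixed version of Y *)

Section Distances.
Context {R : realType}.

Lemma symPos_version (X : 'M[R]_3) a b c : symPos X -> eigenvalues3 X a b c ->
  exists U d, versions X (U, diag_mx d).
Proof.
move=> [Xs Xpos] eX.
have [|Q [d [QQ Qd]]] := @spectral_split R 3 X [:: a; b; c] Xs.
  by rewrite !big_cons big_nil mulr1 mulrA.
have QQ' := mulmx1C QQ.
have QX : X = Q^T *m diag_mx d *m Q.
  by rewrite -Qd !mulmxA QQ' mul1mx -mulmxA QQ' mulmx1.
have d0 i : 0 < d 0 i.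
  have ri : row i Q != 0.
    apply/eqP => ri; have : row i (Q *m Q^T) = 0 by rewrite row_mul ri mul0mx.
    by move=> /rowP/(_ i)/eqP; rewrite QQ !mxE eqxx oner_eq0.
  have := Xpos (row i Q)^T; rewrite trmx_eq0 trmxK => /(_ ri).
  have -> : row i Q *m X *m (row i Q)^T = row i (diag_mx d) *m delta_mx i 0.
    by rewrite tr_row -!row_mul -Qd !rowE colE !mulmxA.
  by rewrite -colE !mxE eqxx mulr1n.
have detQ : \det Q * \det Q = 1 by rewrite -{2}det_tr -det_mulmx QQ det1.
(* [Q] is only orthogonal; multiplying one axis by its determinant gives a rotation and leaves the
   diagonal factor alone. *)
pose e : 'rV[R]_3 := row3 (\det Q) 1 1.
have e2 : diag_mx e *m diag_mx e = 1%:M.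
  rewrite mulmx_diag -diag_const_mx; congr diag_mx; apply/rowP => i.
  by elim/forall_ord3: i; rewrite !mxE /= ?mulr1.
exists (Q^T *m diag_mx e), d; split => /=.
- split; last first.
    by rewrite det_mulmx det_tr det_diag prod_ord3 !mxE /= !mulr1.
  by rewrite trmx_mul trmxK tr_diag_mx mulmxA -(mulmxA Q^T) e2 mulmx1.
- exact: diagPos_diag_mx.
- have ede : diag_mx e *m diag_mx d *m diag_mx e = diag_mx d.
    rewrite !mulmx_diag; congr diag_mx; apply/rowP => i.
    by elim/forall_ord3: i; rewrite !mxE /= ?mul1r ?mulr1 // mulrAC detQ mul1r.
  by rewrite trmx_mul trmxK tr_diag_mx QX -{1}ede !mulmxA.
Qed.

Lemma eigenvalues_version (X U : 'M[R]_3) d a b c :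
  versions X (U, diag_mx d) -> eigenvalues3 X a b c ->
  exists s : 'S_3, d = \row_i row3 a b c 0 (s i).
Proof.
move=> vX eX; apply: prod_XsubC_perm; rewrite -(char_poly_version vX) eX.
by rewrite !big_ord_recl big_ord0 mulr1 !mxE /= mulrA.
Qed.

Lemma eigenvalues_version_inj (X U : 'M[R]_3) d a b c :
  versions X (U, diag_mx d) -> eigenvalues3 X a b c -> uniq [:: a; b; c] ->
  injective (d 0).
Proof.
move=> vX eX u; have [s ->] := eigenvalues_version vX eX.
move=> i j; rewrite !mxE => /eqP; rewrite nth_uniq //.
by move=> /eqP/val_inj/perm_inj.
Qed.

Lemma versions_diag p (X : 'M[R]_p) UD : versions X UD ->
  exists U d, [/\ UD = (U, diag_mx d), rotation U & forall i, 0 < d 0 i].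
Proof.
by case: UD => U D [/= rU /diagPosP[d -> d0] _]; exists U, d.
Qed.

Lemma versions_diag_act (X U V : 'M[R]_3) d D : versions X (U, diag_mx d) ->
  versions X (V, D) -> exists s, D = diag_act (diag_mx d) s.
Proof.
move=> vU vV; have [V' [e [[_ De] _ _]]] := versions_diag vV.
rewrite {}De in vV *; have [s ->] := version_eigenvalues vU vV.
exists (s^-1)%g; rewrite diag_act_diag_mx invgK; congr diag_mx.
Qed.

(** Converse of [versions_frame]: P_s^T P_s and then W D W^T = D cancel in the product. *)
Lemma versions_rotated (X U W : 'M[R]_3) d s : versions X (U, diag_mx d) ->
  rotation W -> W *m diag_mx d = diag_mx d *m W ->
  versions X (U *m W *m (rperm_mx s)^T, diag_act (diag_mx d) s).
Proof.
move=> [/= rU pd ->] rW Wd; have rP := @rotation_rperm R s.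
have [PP _] := rP; have PP' := mulmx1C PP; have [WW _] := rW.
split=> /=.
- by apply: rotationM; [exact: rotationM | exact: rotation_trmx].
- rewrite diag_act_diag_mx; apply: diagPos_diag_mx => i; rewrite mxE.
  by have [_ /(_ ((s^-1)%g i))] := pd; rewrite mxE eqxx mulr1n.
- rewrite /diag_act !trmx_mul trmxK !mulmxA -(mulmxA _ _ (rperm_mx s)) PP' mulmx1.
  rewrite -(mulmxA _ _ (rperm_mx s)) PP' mulmx1.
  by rewrite -(mulmxA U W) Wd mulmxA -(mulmxA _ W) WW mulmx1.
Qed.

(* Moving the second version onto the frame [V *m W] by a signed permutation
   moves the first one to another version of the same matrix. *)
Lemma geo_dist_reframe k (X V W : 'M[R]_3) g l s UD : versions X UD ->
  rotation (diag_mx g) ->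
  exists2 UD', versions X UD' &
    geo_dist k UD (V *m W *m diag_mx g *m (rperm_mx s)^T,
                   diag_act (diag_mx l) s) =
    geo_dist k UD' (V *m W, diag_mx l).
Proof.
move=> vX rg; have [U [d [UDE rU d0]]] := versions_diag vX.
rewrite {}UDE in vX *; have rP := @rotation_rperm R s.
have [PP _] := rP; have PP' := mulmx1C PP.
have [gg _] := rg; rewrite tr_diag_mx in gg.
pose H := rperm_mx s *m diag_mx g; have rH : rotation H by exact: rotationM.
have Hd := signed_perm_conj s d rg; exists (U *m H, H^T *m diag_mx d *m H).
  apply: versions_realign => //; rewrite Hd; apply: diagPos_diag_mx => i.
  by rewrite mxE.
(* [H] is chosen as the inverse of the trailing signed permutation. *)
have VH : V *m W *m diag_mx g *m (rperm_mx s)^T *m H = V *m W.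
  by rewrite /H mulmxA -(mulmxA _ _ (rperm_mx s)) PP' mulmx1 -mulmxA gg mulmx1.
have lH : H^T *m diag_act (diag_mx l) s *m H = diag_mx l.
  rewrite diag_act_diag_mx signed_perm_conj //; congr diag_mx.
  by apply/rowP => i; rewrite !mxE permK.
by rewrite -{2}VH -{2}lH diag_act_diag_mx geo_dist_realign.
Qed.

Lemma versions_distinct (Y V : 'M[R]_3) l VL : versions Y (V, diag_mx l) ->
  injective (l 0) -> versions Y VL ->
  exists g s, rotation (diag_mx g) /\
    VL = (V *m diag_mx g *m (rperm_mx s)^T, diag_act (diag_mx l) s).
Proof.
case: VL => V' L' vV lI vV'; have [s Ls] := versions_diag_act vV vV'.
rewrite Ls in vV' *; have [W [rW Wl ->]] := versions_frame vV vV'.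
exists (\row_i W i i), s; have Wg := commute_diag_inj lI Wl.
by rewrite -Wg.
Qed.

(** All versions of Y are signed permutations of one of them, so reframing keeps that one fixed and
    leaves only the versions of X to vary. *)
Lemma sr_dist_distinct k (X Y V : 'M[R]_3) l m : versions Y (V, diag_mx l) ->
  injective (l 0) ->
  (exists2 UD, versions X UD & m = geo_dist k UD (V, diag_mx l)) ->
  (forall UD, versions X UD -> m <= geo_dist k UD (V, diag_mx l)) ->
  sr_dist k X Y = m.
Proof.
move=> vY lI [UD vX mE] mlb; apply: sr_distE.
  by exists UD, (V, diag_mx l).
move=> UD' VL vX' /(versions_distinct vY lI)[g [s [rg ->]]].
have [UD'' vX''] := geo_dist_reframe k V 1%:M l s vX' rg.
by rewrite mulmx1 => ->; exact: mlb.
Qed.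

(** The versions are in bijection with S_3 times two free signs, the third sign being forced by the
    determinant; 6 times 4 is 24. *)
Lemma card_versions (X : 'M[R]_3) a b c : symPos X -> eigenvalues3 X a b c ->
  uniq [:: a; b; c] -> (versions X #= `I_24)%card.
Proof.
move=> Xpos eX u; have [U [d vX]] := symPos_version Xpos eX.
have dI := eigenvalues_version_inj vX eX u.
pose g (b : bool * bool) : 'rV[R]_3 :=
  row3 ((-1) ^+ b.1) ((-1) ^+ b.2) ((-1) ^+ (b.1 (+) b.2)).
have rg z : rotation (diag_mx (g z)).
  split.
    rewrite tr_diag_mx mulmx_diag -diag_const_mx; congr diag_mx.
    apply/rowP => i; rewrite !mxE.
    by elim/forall_ord3: i; rewrite /= -expr2 sqrr_sign.
  rewrite det_diag prod_ord3 !mxE /= signr_addb.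
  by case: z.1; case: z.2; rewrite /= ?expr0 ?expr1; ring.
pose f (x : 'S_3 * (bool * bool)) :=
  (U *m diag_mx (g x.2) *m (rperm_mx x.1)^T, diag_act (diag_mx d) x.1).
have fI : injective f.
  move=> [s x] [s' x'] [] /= + /esym; rewrite !diag_act_diag_mx.
  (* Distinct eigenvalues recover the permutation from the diagonal part; the signs then follow by
     cancelling U and P_s. *)
  move=> UE /matrixP dE; have ss : s = s'.
    apply: invg_inj; apply/permP => i; have := dE i i; rewrite !mxE eqxx !mulr1n.
    by move=> /dI.
  rewrite {}ss in UE *; congr (_, _).
  have [PP _] := @rotation_rperm R s'.
  have PP' := mulmx1C PP; have [[UU _] _ _] := vX; have UU' := mulmx1C UU.
  have /matrixP gE : diag_mx (g x) = diag_mx (g x').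
    have := congr1 (fun M => U^T *m M *m rperm_mx s') UE.
    by rewrite !mulmxA UU' !mul1mx -!mulmxA PP' !mulmx1.
  clear UE; case: x x' gE => [b1 b2] [b1' b2'] gE.
  have := gE o0 o0; have := gE o1 o1; rewrite !mxE /= !mulr1n.
  by move=> /signr_inj -> /signr_inj ->.
have vE : versions X = range f.
  apply/seteqP; split=> [UD | _ [[s x] _ <-]].
    move=> /(versions_distinct vX dI)[h [s [rh ->]]].
    have hs i : exists b : bool, h 0 i = (-1) ^+ b.
      have /eqP := rotation_diag_sqr rh i; rewrite sqrf_eq1 => /orP[]/eqP ->.
        by exists false.
      by exists true.
    have [b0 h0] := hs o0; have [b1 h1] := hs o1.
    exists (s, (b0, b1)) => //; rewrite /f /=; suff -> : h = g (b0, b1) by [].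
    apply/rowP => i; elim/forall_ord3: i; rewrite [RHS]mxE /= ?h0 ?h1 //.
    have [_] := rh; rewrite det_diag prod_ord3 h0 h1 -signr_addb => h2.
    by apply: (inv_inj (signrMK (b0 (+) b1))); rewrite h2 -expr2 sqrr_sign.
  apply: versions_rotated => //; rewrite !mulmx_diag; congr diag_mx.
  by apply/rowP => i; rewrite !mxE mulrC.
have cT : #|{: 'S_3 * (bool * bool)}| = 24%N.
  by rewrite !card_prod card_bool card_Sn.
have -> : versions X = (f \o enum_val) @` [set: 'I_(#|{: 'S_3 * (bool * bool)}|)].
  rewrite vE; apply/seteqP; split=> [_ [x _ <-] | _ [i _ <-]].
    by exists (enum_rank x) => //=; rewrite enum_rankK.
  by exists (enum_val i).
rewrite (card_eql (inj_card_eq _)); last first.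
  by move=> i j _ _ /fI /enum_val_inj.
by rewrite cT card_eq_sym; exact: card_II.
Qed.

(** The permuted diagonal depends only on the position s gives to the single entry c, and the three
    chosen permutations put it in last, first and middle place. *)
Lemma pis_cover (a c : R) s :
  exists i, diag_act (diag3 a a c) s = diag_act (diag3 a a c) (pis i).
Proof.
have last3 (u : 'S_3) i : row3 a a c 0 ((u^-1)%g i) = if i == u o2 then c else a.
  have -> : (i == u o2) = ((u^-1)%g i == o2).
    by rewrite -(inj_eq (@perm_inj _ u) _ o2) permKV.
  by move: ((u^-1)%g i) => j; elim/forall_ord3: j; rewrite mxE.
suff [i pi2] : exists i, pis i o2 = s o2.
  exists i; rewrite !diag_act_diag_mx; congr diag_mx; apply/rowP => j.
  by rewrite [LHS]mxE [RHS]mxE !last3 pi2.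
move: (s o2) => j; elim/forall_ord3: j.
- by exists o1; rewrite /pis /= permE; exact: val_inj.
- exists o2; rewrite /pis /= (_ : o2 = inord 2) ?tpermR; apply: val_inj.
    by rewrite /= inordK.
  by rewrite /= inordK.
- by exists o0; rewrite /pis /= perm1.
Qed.

(** The permutation is replaced by its representative [pis i] before the frame is computed, so that
    an exchange of the two equal eigenvalues is absorbed into W. *)
Lemma versions_two (X U : 'M[R]_3) a c UD : a != c ->
  versions X (U, diag3 a a c) -> versions X UD ->
  exists t i j, UD = (rotated U (rotz t) (sigmas j) (pis i),
                      diag_act (diag3 a a c) (pis i)).
Proof.
case: UD => U' D' ac vU vU'; have [s Ds] := versions_diag_act vU vU'.
have [i Di] := pis_cover a c s; rewrite {}Ds {}Di in vU' *.
have [W [rW Wd ->]] := versions_frame vU vU'.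
have [t [j ->]] := commute_diag3_rotz ac rW Wd.
by exists t, i, j; rewrite /rotated !mulmxA.
Qed.

Lemma rotation_rotated (U : 'M[R]_3) t j s : rotation U ->
  rotation (rotated U (rotz t) (sigmas j) s).
Proof.
move=> rU; apply: rotationM; last exact/rotation_trmx/rotation_rperm.
apply: rotationM; last exact: rotation_sigmas.
by apply: rotationM => //; exact: rotation_rotz.
Qed.

Lemma versions_two_rotated (X U : 'M[R]_3) a c t i j :
  versions X (U, diag3 a a c) ->
  versions X (rotated U (rotz t) (sigmas j) (pis i),
              diag_act (diag3 a a c) (pis i)).
Proof.
move=> vX; rewrite /rotated -(mulmxA U); apply: versions_rotated => //.
  by apply: rotationM; [exact: rotation_rotz | exact: rotation_sigmas].
rewrite -mulmxA mulmx_diag.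
have -> : \row_i (sigmas j 0 i * row3 a a c 0 i) =
    \row_i (row3 a a c 0 i * sigmas j 0 i).
  by apply/rowP => x; rewrite !mxE mulrC.
by rewrite -mulmx_diag mulmxA rotz_commute_diag3 mulmxA.
Qed.

Lemma trace_maximizer_exists (U V : 'M[R]_3) sg s :
  exists theta phi, maximizes_trace U V sg s theta phi.
Proof.
apply: (bilinear_rotz_max (f := fun A B =>
  \tr (U *m A *m diag_mx sg *m (rperm_mx s)^T *m B^T *m V^T))).
  move=> A a B C.
  by rewrite linearP /= mulmxDr mulmxDl -scalemxAr -scalemxAl linearP.
by move=> B a A C; rewrite mulmxDr -scalemxAr !mulmxDl -!scalemxAl linearP.
Qed.

End Distances.

(** * The four eigenvalue patterns *)

Section Parts.
Context {R : realType}.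
Implicit Types X Y U V : 'M[R]_3.

Lemma min_ord2_le m n (F : 'I_m.+1 -> 'I_n.+1 -> R) i j :
  min_ord (fun i => min_ord (F i)) <= F i j.
Proof. by apply: le_trans (min_ord_le _ i) _; exact: min_ord_le. Qed.

Lemma min_ord2_attained m n (F : 'I_m.+1 -> 'I_n.+1 -> R) :
  exists i j, min_ord (fun i => min_ord (F i)) = F i j.
Proof.
have [i ->] := min_ord_attained (fun i => min_ord (F i)).
by have [j ->] := min_ord_attained (F i); exists i, j.
Qed.

Lemma sr_dist_all_distinct k X Y l1 l2 l3 n (UD : 'I_n.+1 -> 'M[R]_3 * 'M[R]_3) VL :
  eigenvalues3 Y l1 l2 l3 -> uniq [:: l1; l2; l3] ->
  range UD = versions X -> versions Y VL ->
  sr_dist k X Y = min_ord (fun i => geo_dist k (UD i) VL).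
Proof.
move=> eY uY UDX vY; have [V [l [VLE _ _]]] := versions_diag vY.
rewrite {}VLE in vY *.
apply: (sr_dist_distinct vY (eigenvalues_version_inj vY eY uY)).
  have [i ->] := min_ord_attained (fun i => geo_dist k (UD i) (V, diag_mx l)).
  by exists (UD i) => //; rewrite -UDX; exists i.
move=> UD'; rewrite -UDX => -[i _ <-].
exact: (min_ord_le (fun i => geo_dist k (UD i) (V, diag_mx l))).
Qed.

(** With the diagonal parts fixed, minimizing the distance means maximizing a trace that is linear
    in the rotation. *)
Lemma minimal_rotation_exists k U V a c l j i : 0 < k ->
  0 < a -> 0 < c -> rotation U -> rotation V ->
  exists B, minimal_rotation k (U, diag3 a a c) (V, diag_mx l) (sigmas j) (pis i) B.
Proof.
move=> k0 a0 c0 rU rV.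
(* The second factor is 1 on rotations about the third axis; it only makes
   the expression bilinear. *)
have [||t [v tmax]] := bilinear_rotz_max (f := fun A B =>
  \tr (V *m (rotated U A (sigmas j) (pis i))^T) * B o2 o2).
- by move=> A b B C; rewrite !mxE mulrDr mulrCA.
- move=> B b A C; rewrite /rotated mulmxDr -scalemxAr !mulmxDl -!scalemxAl linearP.
  by rewrite /= mulmxDr -scalemxAr linearP /= mulrDl -mulrA.
exists (rotz t); split; first by apply/block_rotP; exists t.
move=> C /block_rotP[u ->]; rewrite diag_act_diag_mx /= le_geo_dist //.
- by have := tmax u 0; rewrite !rotzE !mxE /= !mulr1.
- exact: rotation_rotated.
- exact: rotation_rotated.
- move=> x; rewrite mxE; move: ((pis i)^-1%g x) => y.
  by elim/forall_ord3: y; rewrite mxE.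
Qed.

(** With the version of Y fixed, the versions of X are covered by six circles, and the minimal
    rotation gives the least distance on each. *)
Lemma sr_dist_two_distinct k X Y U l1 l2 l3 a c VL (B : 'I_3 -> 'I_2 -> 'M[R]_3) :
  a != c -> versions X (U, diag3 a a c) ->
  eigenvalues3 Y l1 l2 l3 -> uniq [:: l1; l2; l3] -> versions Y VL ->
  (forall i j, minimal_rotation k (U, diag3 a a c) VL (sigmas j) (pis i) (B i j)) ->
  sr_dist k X Y = min_ord (fun i => min_ord (fun j =>
    geo_dist k (rotated U (B i j) (sigmas j) (pis i),
                diag_act (diag3 a a c) (pis i)) VL)).
Proof.
move=> ac vX eY uY vY Bmin; have [V [l [VLE _ _]]] := versions_diag vY.
rewrite {}VLE in vY Bmin *.
apply: (sr_dist_distinct vY (eigenvalues_version_inj vY eY uY)).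
  have [i [j ->]] := min_ord2_attained (fun i j =>
    geo_dist k (rotated U (B i j) (sigmas j) (pis i),
                diag_act (diag3 a a c) (pis i)) (V, diag_mx l)).
  exists (rotated U (B i j) (sigmas j) (pis i),
          diag_act (diag3 a a c) (pis i)) => //.
  have [/block_rotP[t ->] _] := Bmin i j.
  exact: versions_two_rotated.
move=> UD /(versions_two ac vX)[t [i [j ->]]].
apply: le_trans (min_ord2_le (fun i j => geo_dist k
    (rotated U (B i j) (sigmas j) (pis i), diag_act (diag3 a a c) (pis i))
    (V, diag_mx l)) i j) _.
by have [_ ->] := Bmin i j; last by apply/block_rotP; exists t.
Qed.

Lemma sr_dist_two_two k X Y U V a c b e (theta phi : 'I_3 -> 'I_2 -> R) :
  0 < k -> a != c -> b != e ->
  versions X (U, diag3 a a c) -> versions Y (V, diag3 b b e) ->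
  (forall i j, maximizes_trace U V (sigmas j) (pis i) (theta i j) (phi i j)) ->
  sr_dist k X Y = min_ord (fun i => min_ord (fun j =>
    geo_dist k (rotated U (rotz (theta i j)) (sigmas j) (pis i),
                diag_act (diag3 a a c) (pis i))
               (V *m rotz (phi i j), diag3 b b e))).
Proof.
move=> k0 ac be vX vY Gmax; have [rU dX _] := vX; have [rV _ _] := vY.
(* [rotz u] commutes with diag(b, b, e), so it moves the frame of Y and keeps the diagonal part. *)
have vYr u : versions Y (V *m rotz u, diag3 b b e).
  have [rr _] := rotation_rotz u; have rr' := mulmx1C rr.
  have rD : (rotz u)^T *m diag3 b b e *m rotz u = diag3 b b e.
    by rewrite -mulmxA -rotz_commute_diag3 mulmxA rr' mul1mx.
  rewrite -rD; apply: versions_realign => //; first exact: rotation_rotz.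
  by rewrite rD; have [] := vY.
apply: sr_distE.
  have [i [j ->]] := min_ord2_attained (fun i j =>
    geo_dist k (rotated U (rotz (theta i j)) (sigmas j) (pis i),
                diag_act (diag3 a a c) (pis i))
               (V *m rotz (phi i j), diag3 b b e)).
  exists (rotated U (rotz (theta i j)) (sigmas j) (pis i),
          diag_act (diag3 a a c) (pis i)), (V *m rotz (phi i j), diag3 b b e).
  by split; [exact: versions_two_rotated | exact: vYr | reflexivity].
move=> UD [V' L'] vX' vY'; have [s Ls] := versions_diag_act vY vY'.
rewrite {}Ls in vY' *; have [W [rW Wl ->]] := versions_frame vY vY'.
have [u [j' ->]] := commute_diag3_rotz be rW Wl.
(* The sign and permutation of the version of Y are carried over to that of X, leaving V R_u on one
   side and one of the six families on the other. *)
have [UD' vX''] :=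
  geo_dist_reframe k V (rotz u) (row3 b b e) s vX' (rotation_sigmas j').
rewrite (mulmxA V) => ->.
have [t [i [j ->]]] := versions_two ac vX vX''.
apply: le_trans (min_ord2_le (fun i j =>
    geo_dist k (rotated U (rotz (theta i j)) (sigmas j) (pis i),
                diag_act (diag3 a a c) (pis i))
               (V *m rotz (phi i j), diag3 b b e)) i j) _.
have rVr x : rotation (V *m rotz x) by apply: rotationM => //; exact: rotation_rotz.
(* A trace is unchanged by transposition, so the trace that governs the distance is G. *)
have trG t' u' : \tr (V *m rotz u' *m (rotated U (rotz t') (sigmas j) (pis i))^T) =
    \tr (U *m rotz t' *m diag_mx (sigmas j) *m (rperm_mx (pis i))^T
         *m (rotz u')^T *m V^T).
  by rewrite -mxtrace_tr !trmx_mul !trmxK !mulmxA.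
rewrite diag_act_diag_mx le_geo_dist ?trG //; try exact: rotation_rotated.
  exact: Gmax.
move=> x; rewrite mxE; have := dX.2 ((pis i)^-1%g x).
by rewrite [X in 0 < X]mxE eqxx mulr1n.
Qed.

Lemma diag3_const (a : R) : diag3 a a a = a%:M.
Proof. by rewrite diag3E scalar_mx3. Qed.

(** X is a times the identity, so every rotation, V included, gives a version of X and the angle can
    be made zero. *)
Lemma sr_dist_scalar k X Y V L a : 0 < k -> symPos X -> eigenvalues3 X a a a ->
  versions Y (V, L) ->
  sr_dist k X Y = geo_dist k (V, diag3 a a a) (V, L).
Proof.
move=> k0 Xpos eX vY; have [U [d vX]] := symPos_version Xpos eX.
have dE (U' : 'M[R]_3) e : versions X (U', diag_mx e) -> diag_mx e = diag3 a a a.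
  move=> v; have [s ->] := eigenvalues_version v eX.
  congr diag_mx; apply/rowP => i; rewrite mxE.
  by elim/forall_ord3: (s i); elim/forall_ord3: i; rewrite !mxE.
have De := dE _ _ vX; have [[UU _] pd XE] := vX; rewrite /= De diag3_const in pd XE.
have Xa : X = a%:M by rewrite XE mul_mx_scalar -scalemxAl UU scalemx1.
have a0 : 0 < a by have [_ /(_ o0)] := pd; rewrite mxE eqxx mulr1n.
have row_a i : 0 < row3 a a a 0 i by elim/forall_ord3: i; rewrite mxE.
have [V0 [l [[_ Ll] rV l0]]] := versions_diag vY; rewrite {}Ll in vY *.
have {}rV : rotation V by have [] := vY.
have [VV _] := rV.
apply: sr_distE.
  exists (V, diag3 a a a), (V, diag_mx l); split=> //; split=> //=.
    by rewrite diag3_const.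
  by rewrite diag3_const mul_mx_scalar -scalemxAl VV scalemx1 Xa.
move=> UD [V' L'] vX' vY'; have [U' [d' [UDE rU' d0']]] := versions_diag vX'.
rewrite {}UDE in vX' *; rewrite (dE _ _ vX').
have rV' : rotation V' by have [] := vY'.
have [s Ls] := versions_diag_act vY vY'; rewrite {}Ls diag_act_diag_mx.
rewrite !geo_distE // VV /rotangle mxtrace_scalar.
rewrite (_ : (3%:R - 1) / 2 = 1 :> R) ?acos1; last by field.
rewrite expr0n /= mulr0 add0r; apply: ler_wsqrtr.
(* Every diagonal entry of X is a, so permuting the eigenvalues of Y leaves the diagonal term
   unchanged. *)
rewrite [leLHS](reindex_perm (s^-1)%g) /=.
have -> : \sum_i ln (l 0 ((s^-1)%g i) / row3 a a a 0 ((s^-1)%g i)) ^+ 2 =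
    \sum_i ln ((\row_i l 0 ((s^-1)%g i)) 0 i / row3 a a a 0 i) ^+ 2.
  apply: eq_bigr => i _; rewrite mxE; congr (ln (_ / _) ^+ 2).
  by elim/forall_ord3: ((s^-1)%g i); elim/forall_ord3: i; rewrite !mxE.
by rewrite lerDr mulr_ge0 ?sqr_ge0 // ltW.
Qed.

End Parts.

(** Existence of the minimal rotations in (ii) and of the maximizing angles in (iii) is asserted as
    well, so that the formulas quantified over them are not vacuous. *)
Theorem theorem4p3 (R : realType) (k : R) (k_gt0 : 0 < k) (X Y : 'M[R]_3)
    (Xpos : symPos X) (Ypos : symPos Y) (d1 d2 d3 l1 l2 l3 : R)
    (eigX : eigenvalues3 X d1 d2 d3) (eigY : eigenvalues3 Y l1 l2 l3) :
  [/\ (* (i) *)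
      uniq [:: d1; d2; d3] -> uniq [:: l1; l2; l3] ->
      (versions X #= `I_24)%card /\
      forall UD : 'I_24 -> 'M[R]_3 * 'M[R]_3,
        injective UD -> range UD = versions X ->
        forall VL, versions Y VL ->
        sr_dist k X Y = min_ord (fun i => geo_dist k (UD i) VL),
      (* (ii) *)
      d1 = d2 -> d2 != d3 -> uniq [:: l1; l2; l3] ->
      forall VL, versions Y VL ->
      forall U D, D = diag3 d1 d1 d3 -> versions X (U, D) ->
        (forall (i : 'I_3) (j : 'I_2), exists B,
            minimal_rotation k (U, D) VL (sigmas j) (pis i) B) /\
        forall Rhat : 'I_3 -> 'I_2 -> 'M[R]_3,
        (forall i j,
            minimal_rotation k (U, D) VL (sigmas j) (pis i) (Rhat i j)) ->
        sr_dist k X Y = min_ord (fun i => min_ord (fun j =>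
          geo_dist k (rotated U (Rhat i j) (sigmas j) (pis i),
                      diag_act D (pis i)) VL)),
      (* (iii) *)
      d1 = d2 -> d2 != d3 -> l1 = l2 -> l2 != l3 ->
      forall D L, D = diag3 d1 d2 d3 -> L = diag3 l1 l2 l3 ->
      forall U V, versions X (U, D) -> versions Y (V, L) ->
        (forall (i : 'I_3) (j : 'I_2), exists theta phi,
            maximizes_trace U V (sigmas j) (pis i) theta phi) /\
        forall theta phi : 'I_3 -> 'I_2 -> R,
        (forall i j,
            maximizes_trace U V (sigmas j) (pis i) (theta i j) (phi i j)) ->
        sr_dist k X Y = min_ord (fun i => min_ord (fun j =>
          geo_dist k (rotated U (rotz (theta i j)) (sigmas j) (pis i),
                      diag_act D (pis i))
                     (V *m rotz (phi i j), L)))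
    & (* (iv) *)
      d1 = d2 -> d2 = d3 ->
      forall D, D = diag3 d1 d1 d1 ->
      forall V L, versions Y (V, L) ->
        sr_dist k X Y = geo_dist k (V, D) (V, L)].
Proof.
split.
- move=> uX uY; split; first exact: card_versions Xpos eigX uX.
  by move=> UD _ UDX VL; exact: (sr_dist_all_distinct k eigY uY UDX).
- move=> d12 d23 uY VL vY U D -> vX.
  have d13 : d1 != d3 by rewrite d12.
  split=> [i j | B]; last exact: (sr_dist_two_distinct d13 vX eigY uY vY).
  have [V [l [VLE rV _]]] := versions_diag vY; rewrite VLE.
  have [rU [_ dpos] _] := vX.
  apply: minimal_rotation_exists => //.
    by have := dpos o0; rewrite /= !mxE eqxx mulr1n.
  by have := dpos o2; rewrite /= !mxE eqxx mulr1n.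
- move=> d12 d23 l12 l23 D L DE LE U V vX vY.
  rewrite {}DE {}LE -{}d12 -{}l12 in d23 l23 vX vY *.
  split=> [i j | theta phi]; first exact: trace_maximizer_exists.
  exact: (sr_dist_two_two k_gt0 d23 l23 vX vY).
- move=> d12 d23 D -> V L vY; apply: sr_dist_scalar => //.
  by rewrite -d23 -d12 in eigX.
Qed.
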